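(* Let $\lambda$ be a singular strong limit cardinal. Then the following are equivalent: (a) $\lambda^+\in I[\lambda^+]$; (b) $S^{\lambda^+}_\tau\in I[\lambda^+]$ for all regular $\tau<\lambda$; (c) $\mathrm{CECA}(\lambda^+)$; (d) $\mathrm{CECA}_\tau(\lambda^+)$ holds for all regular $\tau<\lambda$.
   Context: Regular cardinals are understood to be infinite. $[X]^{\tau}$ (resp. $[X]^{<\tau}$) is the set of subsets of $X$ of cardinality $\tau$ (resp. $<\tau$). $H(\Theta)$ is the set of all sets hereditarily of cardinality $<\Theta$. $S^{\lambda^+}_\tau=\{\alpha<\lambda^+: cf(\alpha)=\tau\}$. $I[\kappa]$ (for $\kappa$ regular uncountable) is the family of all $A\subseteq\kappa$ such that $\{\delta\in A:\delta=cf(\delta)\}$ is not stationary in $\kappa$ and for some sequence $\langle\mathcal P_\alpha:\alpha<\kappa\rangle$: (i) each $\mathcal P_\alpha$ is a family of fewer than $\kappa$ subsets of $\alpha$; (ii) for every limit $\alpha\in A$ with $cf(\alpha)<\alpha$ there is $x\subset\alpha$ such that $otp(x)<\alpha=\sup x$ and for all $\beta<\alpha$, $x\cap\beta\in\bigcup_{\gamma<\alpha}\mathcal P_\gamma$. For a regular cardinal $\tau$, a set $M$ is weakly $\tau$-closed if for every $I\in[M]^\tau$ there is $J\in[I]^\tau$ with $[J]^{<\tau}\subset M$. $M$ is weakly closed if it is weakly $\tau$-closed for all regular $\tau$ (equivalently, for all regular $\tau\le|M|$). An $\in$-chain is a sequence $\langle M_\xi:\xi<\alpha\rangle$ such that $M_\xi\subset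 M_\eta$ and $\langle M_\xi:\xi\le\eta\rangle\in M_{\eta+1}$ for all $\xi<\eta<\alpha$; it is continuous if unions are taken at limit indices. $\mathrm{CECA}_\tau(\kappa)$, for a cardinal $\kappa$: for every cardinal $\Theta>\kappa$, and for every pair of sets $A,B$ with $|A|=\kappa$, $|B|<\kappa$, there exists a continuous $\in$-chain $\langle M_\xi\rangle_{\xi<cf(\kappa)}$ of weakly $\tau$-closed elementary submodels of $H(\Theta)$ such that $|M_\xi|<\kappa$ for every $\xi<cf(\kappa)$, $B\in M_0$, and $A\subset\bigcup_{\xi<cf(\kappa)}M_\xi$. $\mathrm{CECA}(\kappa)$ is the same statement with ''weakly $\tau$-closed'' replaced by ''weakly closed''.
   Formalization: In CECA and CECA_τ, the sets A and B range over subsets of H(Θ) rather than over all sets; for unrestricted A the conclusion A ⊂ ⋃M_ξ ⊂ H(Θ) would fail for every κ. *)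

(* Defs.v *)
From HB Require Import structures.
From mathcomp Require Import all_boot.
From mathcomp Require Import mathcomp_extra boolp classical_sets functions.
From mathcomp Require Import cardinality.

Set Implicit Arguments.
Unset Strict Implicit.
Unset Printing Implicit Defensive.

Local Open Scope classical_set_scope.
Local Open Scope card_scope.

(** * The universe of sets

    [V] is the quotient of the type of well-founded trees by bisimilarity, so
    that extensionality is Leibniz equality; with the classical axioms of
    [boolp] it satisfies ZFC. An element of [V] is a bisimilarity class.
    [set V] is the type of all subclasses of [V].

    Universe pitfall: the index types of [tree] live strictly below the type
    [V], to which the monomorphic constant [set] is applied; hence an index
    type must not be of the form [set T] (write [T -> Prop]), nor a
    [set_type]. *)

Inductive tree : Type := node (X : Type) (f : X -> tree).

Fixpoint bisim (s t : tree) {struct s} : Prop :=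
  match s, t with
  | node X f, node Y g =>
      (forall i, exists j, bisim (f i) (g j)) /\
      (forall j, exists i, bisim (f i) (g j))
  end.

Definition V : Type := {C : tree -> Prop | exists t, C = bisim t}.

HB.instance Definition _ := gen_eqMixin V.
HB.instance Definition _ := gen_choiceMixin V.

Definition vin (x y : V) : Prop :=
  exists X (f : X -> tree) i, sval x (f i) /\ sval y (node f).

Notation "x ∈ y" := (vin x y) (at level 70, no associativity).

Definition ext (y : V) : set V := [set x | x ∈ y].
Coercion ext : V >-> set.

Definition vempty : V :=
  let t := node (fun i : False => match i return tree with end) in
  exist _ (bisim t) (ex_intro _ t erefl).

(** The set with extension [A], for a class [A] that is a set; it is [vempty]
    if [A] is a proper class. *)
Definition vset (A : set V) : V := xget vempty [set x : V | ext x = A].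

Definition opair (x y : V) : V :=
  vset [set vset [set x]; vset [set x; y]].

(** The restriction of [M] to the elements of [D], as a set of pairs. *)
Definition vseq (M : V -> V) (D : V) : V :=
  vset [set opair xi (M xi) | xi in D].

(** * Ordinals and cardinals (von Neumann) *)

Definition transitive_set (x : V) := forall y, y ∈ x -> y `<=` x.

Definition is_ordinal (a : V) :=
  transitive_set a /\ forall b, b ∈ a -> transitive_set b.

Definition ord_le (a b : V) := a ∈ b \/ a = b.

Definition ord_succ (a : V) : V := vset (a `|` [set a]).

Definition limit_ordinal (a : V) :=
  [/\ is_ordinal a, a <> vempty & forall b, b ∈ a -> exists2 c, c ∈ a & b ∈ c].

(** The least ordinal in the class [P]; [vempty] if there is none. *)
Definition least (P : set V) : V :=
  xget vempty [set a | [/\ is_ordinal a, P a & forall b, b ∈ a -> ~ P b]].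

(** Least upper bound of a set of ordinals. *)
Definition ord_sup (x : V) : V :=
  least [set a | forall c, c ∈ x -> ord_le c a].

Definition otp (x : V) : V :=
  least [set r : V | exists2 f : V -> V, set_bij x r f &
    forall y z, y ∈ x -> z ∈ x -> (y ∈ z <-> f y ∈ f z)].

Definition cf (a : V) : V :=
  least [set m | exists2 f : V -> V, (forall xi, xi ∈ m -> f xi ∈ a) &
    forall b, b ∈ a -> exists2 xi, xi ∈ m & ord_le b (f xi)].

Definition card_lt (A B : set V) : bool := (A #<= B) && ~~ (B #<= A).
Notation "A '#<' B" := (card_lt A B) (at level 79, format "A  '#<'  B").

Definition is_cardinal (k : V) :=
  is_ordinal k /\ forall a : V, a ∈ k -> ~~ (a #= k).

Definition regular (k : V) := [/\ is_cardinal k, infinite_set k & cf k = k].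

Definition singular (k : V) := [/\ is_cardinal k, infinite_set k & cf k ∈ k].

Definition strong_limit (k : V) :=
  forall m : V, is_cardinal m -> m ∈ k -> [set x : V | x `<=` m] #< k.

Definition succ_card (k : V) : V := least [set a : V | k #< a].

(** * The ideal I[k] *)

Definition club (k : V) (C : set V) :=
  [/\ C `<=` k,
      forall a, a ∈ k -> exists2 b, C b & a ∈ b
    & forall d, d ∈ k -> limit_ordinal d ->
        (forall a, a ∈ d -> exists b, [/\ C b, a ∈ b & b ∈ d]) -> C d].

Definition stationary (k : V) (S : set V) :=
  S `<=` k /\ forall C, club k C -> S `&` C !=set0.

(** Meaningful for [k] a regular uncountable cardinal. *)
Definition approachability_ideal (k : V) : set (set V) :=
  [set A : set V |
    [/\ A `<=` k,
        ~ stationary k [set d | A d /\ d = cf d]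
      & exists P : V -> V,
          (forall a : V, a ∈ k ->
             P a #< k /\ forall y : V, y ∈ P a -> y `<=` a) /\
          (forall a : V, A a -> limit_ordinal a -> cf a ∈ a ->
             exists x : V,
               [/\ x `<=` a, otp x ∈ a, ord_sup x = a
                 & forall b : V, b ∈ a ->
                     exists2 c, c ∈ a & vset (x `&` b) ∈ P c])]].

Definition cof_stratum (k tau : V) : set V :=
  [set a | a ∈ k /\ cf a = tau].

(** * Elementary submodels *)

(** First-order formulas in the language of set theory, with variables named
    by natural numbers. *)
Inductive formula : Type :=
  | FMem (i j : nat)
  | FEq (i j : nat)
  | FNot (p : formula)
  | FAnd (p q : formula)
  | FEx (i : nat) (p : formula).

Fixpoint sat (D : set V) (v : nat -> V) (p : formula) : Prop :=
  match p with
  | FMem i j => v i ∈ v j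
  | FEq i j => v i = v j
  | FNot p => ~ sat D v p
  | FAnd p q => sat D v p /\ sat D v q
  | FEx i p => exists2 a, D a & sat D [eta v with i |-> a] p
  end.

Definition elementary_submodel (M N : set V) :=
  [/\ M !=set0, M `<=` N
    & forall p v, (forall i, M (v i)) -> (sat M v p <-> sat N v p)].

(** The sets hereditarily of cardinality [< T]: the set, its elements, the
    elements of its elements, etc. all have cardinality [< T]. For regular [T]
    this is the same as having a transitive closure of cardinality [< T]. *)
Inductive Hset (T : V) : V -> Prop :=
  | Hset_intro (x : V) : x #< T -> (forall y, y ∈ x -> Hset T y) -> Hset T x.

(** * Weakly closed sets and chains *)

Definition weakly_tau_closed (tau M : V) :=
  forall I : V, I `<=` M -> I #= tau ->
    exists J : V, [/\ J `<=` I, J #= tau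
      & forall x : V, x `<=` J -> x #< tau -> x ∈ M].

Definition weakly_closed (M : V) :=
  forall tau, regular tau -> weakly_tau_closed tau M.

(** The sequence [<M xi : xi <= eta>] is [M] restricted to [eta + 1]. *)
Definition in_chain (a : V) (M : V -> V) :=
  (forall xi eta, xi ∈ eta -> eta ∈ a -> M xi `<=` M eta) /\
  (forall eta, eta ∈ a -> ord_succ eta ∈ a ->
     vseq M (ord_succ eta) ∈ M (ord_succ eta)).

Definition continuous_chain (a : V) (M : V -> V) :=
  forall d, d ∈ a -> limit_ordinal d ->
    ext (M d) = \bigcup_(xi in ext d) M xi.

(** [A] and [B] range over the subsets of [Hset T]: the conclusion forces [A] to
    be one, and [B] to be an element of [Hset T]; for [B] of cardinality [< T]
    the latter just means that [B] is a subset of [Hset T]. *)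
Definition CECA_with (closed : V -> Prop) (k : V) :=
  forall T : V, is_cardinal T -> k ∈ T ->
  forall A B : V, A `<=` Hset T -> B `<=` Hset T -> A #= k -> B #< k ->
  exists M : V -> V,
    [/\ in_chain (cf k) M /\ continuous_chain (cf k) M,
        forall xi, xi ∈ cf k -> closed (M xi) /\ elementary_submodel (M xi) (Hset T),
        forall xi, xi ∈ cf k -> M xi #< k,
        B ∈ M vempty
      & A `<=` \bigcup_(xi in ext (cf k)) M xi].

Definition CECA_tau (tau k : V) := CECA_with (weakly_tau_closed tau) k.

Definition CECA (k : V) := CECA_with weakly_closed k.

(* Main.v *)
Require Import Defs.
From HB Require Import structures.
From mathcomp Require Import all_boot.
From mathcomp Require Import mathcomp_extra boolp classical_sets functions.
From mathcomp Require Import cardinality.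

(** Write [K] for the successor of [lambda].

    (d) to (a): for each regular [tau < lambda] take a chain [M_tau] covering
    [K], and let the family at [c] collect the subsets of [c] lying in some
    [M_tau c]. Suppose [d < K] is a limit of cofinality [tau] and is included in
    [M_tau d]. A cofinal subset of [d] of order type [tau] is a subset of
    [M_tau d], so by weak closure it has a subset of size [tau], again cofinal in
    [d], whose proper initial segments belong to [M_tau d] and hence to an
    earlier model. For the remaining [d] there is some [al < d] that enters the
    chains only at or after [d], so that [d] is bounded by an ordinal [g al < K]
    depending on [al] only; the families from [al] on can then afford to list
    the initial segments of a fixed cofinal subset of every such [d].

    (b) to (c): approachability yields [W c], a family of at most [lambda] subsets
    of [c + 1] of size [< lambda], such that every limit [d < K] has a cofinal
    subset [x] whose proper initial segments are enumerated by [W] before [d].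
    Each model [M eta] is an increasing union of [lambda] small pieces
    [slice h (M eta) al], [al < lambda]. The chain is built so that for each [w]
    in [W c] and each [al], the at most [lambda] subsets of the union of the
    pieces [slice h (M eta) al], [eta] in [w], are thrown in after stage [c].
    For [I] of size [tau] inside [M d], [d] a limit, two pigeonhole arguments
    thin [I] out to a [J] of size [tau] all of whose subsets of size [< tau] are
    contained in such a union, with [w] a proper initial segment of [x]. The same
    argument applied to a chain of length omega makes the successor models weakly
    closed. *)

Set Implicit Arguments.
Unset Strict Implicit.
Unset Printing Implicit Defensive.

Local Open Scope classical_set_scope.
Local Open Scope card_scope.

(** * The universe of sets *)

HB.instance Definition _ := isPointed.Build V vempty.

Lemma bisim_refl t : bisim t t.
Proof. by elim: t => X f IH; split => i; exists i. Qed.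

Lemma bisim_sym s t : bisim s t -> bisim t s.
Proof.
elim: s t => X f IH [Y g] [fg gf]; split.
  by move=> j; have [i /IH] := gf j; exists i.
by move=> i; have [j /IH] := fg i; exists j.
Qed.

Lemma bisim_trans s t u : bisim s t -> bisim t u -> bisim s u.
Proof.
elim: s t u => X f IH [Y g] [Z h] [fg gf] [gh hg]; split.
  by move=> i; have [j ij] := fg i; have [k jk] := gh j; exists k; apply: IH jk.
by move=> k; have [j jk] := hg k; have [i ij] := gf j; exists i; apply: IH jk.
Qed.

Definition vclass (t : tree) : V := exist _ (bisim t) (ex_intro _ t erefl).

Lemma V_eqP (x y : V) : sval x = sval y -> x = y.
Proof.
by case: x y => [C pC] [D pD] /= e; subst D; congr exist; exact: Prop_irrelevance.
Qed.

Lemma vclassE (x : V) : exists t, x = vclass t.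
Proof. by case: (svalP x) => t e; exists t; exact: V_eqP. Qed.

Lemma vclass_eq s t : vclass s = vclass t <-> bisim s t.
Proof.
split; first by move/(congr1 sval) => /= ->; exact: bisim_refl.
move=> st; apply: V_eqP => /=; apply: funext => u; apply: propext; split.
  exact/bisim_trans/bisim_sym.
exact: bisim_trans.
Qed.

Lemma sval_vclass (x : V) t : sval x t -> x = vclass t.
Proof. by have [s ->] := vclassE x => /= st; apply/vclass_eq. Qed.

Lemma vin_node x X (f : X -> tree) :
  x ∈ vclass (node f) <-> exists i, x = vclass (f i).
Proof.
split=> [[Y [g [i [/sval_vclass -> /= [fg gf]]]]]|[i ->]].
  by have [j] := gf i; exists j; apply/vclass_eq/bisim_sym.
by exists X, f, i; split; exact: bisim_refl.
Qed.

Lemma vin_wf : well_founded vin.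
Proof.
move=> x; have [t ->] := vclassE x; elim: t => X f IH.
by constructor => y /vin_node[i ->].
Qed.

Lemma vin_ind (P : V -> Prop) :
  (forall x, (forall y, y ∈ x -> P y) -> P x) -> forall x, P x.
Proof. exact: well_founded_ind vin_wf P. Qed.

Lemma vext (x y : V) : (forall z, z ∈ x <-> z ∈ y) -> x = y.
Proof.
have [[X f] ->] := vclassE x; have [[Y g] ->] := vclassE y => xy.
apply/vclass_eq; split=> [i|j].
  have /xy/vin_node[j /vclass_eq ?] : vclass (f i) ∈ vclass (node f).
    by apply/vin_node; exists i.
  by exists j.
have /xy/vin_node[i /vclass_eq ?] : vclass (g j) ∈ vclass (node g).
  by apply/vin_node; exists j.
by exists i; exact: bisim_sym.
Qed.

Lemma vin_empty x : ~ x ∈ vempty.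
Proof.
have -> : vempty = vclass (node (fun i : False => match i return tree with end)).
  exact: V_eqP.
by move/vin_node => [].
Qed.

(** The tree type bounds the universe of its index types, so the families
    below must be indexed by carriers of trees. *)
Definition vtree (x : V) : tree := sval (cid (vclassE x)).
Lemma vtreeK x : vclass (vtree x) = x.
Proof. by rewrite /vtree; case: cid. Qed.

Definition carrier (t : tree) : Type := let: node X _ := t in X.
Definition branch (t : tree) : carrier t -> tree :=
  match t return carrier t -> tree with node _ f => f end.
Definition idx (x : V) : Type := carrier (vtree x).
Definition elt (x : V) (i : idx x) : V := vclass (branch i).

Lemma vinP (x y : V) : x ∈ y <-> exists i : idx y, x = elt i.
Proof.
rewrite -{1}(vtreeK y) /elt /idx.
by case: (vtree y) => X f; rewrite vin_node.
Qed.

(** * Replacement, separation, union and pairing *)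

Definition is_set (A : set V) := exists y : V, ext y = A.

Lemma vsetE (A : set V) : is_set A -> ext (vset A) = A.
Proof. by move=> [y yA]; rewrite /vset; case: xgetP => [x _ //|/(_ y)]. Qed.

Lemma vsetP (A : set V) x : is_set A -> x ∈ vset A <-> A x.
Proof. by move=> /vsetE E; change (ext (vset A) x <-> A x); rewrite E. Qed.

Lemma family_node (t : tree) (F : carrier t -> V) : is_set (range F).
Proof.
exists (vclass (node (vtree \o F))); apply/seteqP; split=> [x|_ [i _ <-]].
  by move=> /vin_node[i ->]; exists i; rewrite ?vtreeK.
by apply/vin_node; exists i; rewrite /= vtreeK.
Qed.

Lemma is_set_image (F : V -> V) (y : V) : is_set (F @` y).
Proof.
have [z zE] := family_node (fun i : carrier (vtree y) => F (elt (x := y) i)).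
exists z; rewrite zE; apply/seteqP; split=> x /=.
  by move=> [i _ <-]; exists (elt (x := y) i) => //; apply/vinP; exists i.
by move=> [u /vinP[i ->] <-]; exists i.
Qed.

Lemma is_set0 : is_set set0.
Proof. by exists vempty; apply/seteqP; split=> x // /vin_empty. Qed.

Lemma is_set_sub (A : set V) (y : V) : A `<=` y -> is_set A.
Proof.
move=> Ay.
have [[a Aa]|nA] := pselect (exists a, A a); last first.
  have -> : A = set0 by apply/seteqP; split=> // x Ax; apply: nA; exists x.
  exact: is_set0.
(* Separation from replacement: the members of [y] outside [A] are sent to a fixed member [a] of
   [A]. *)
have [z zE] := is_set_image (fun x => if pselect (A x) then x else a) y.
exists z; rewrite zE; apply/seteqP; split=> x /=.
  by move=> [u uy <-]; case: (pselect (A u)).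
by move=> Ax; exists x; [exact: Ay|case: (pselect (A x))].
Qed.

Lemma is_set_bigcup (y : V) (F : V -> set V) :
  (forall x, x ∈ y -> is_set (F x)) -> is_set (\bigcup_(x in ext y) F x).
Proof.
move=> Fset.
pose G i := vset (F (elt (x := y) i)).
(* Only the carrier of [t] matters, as an index type for the union; its branches are dummies. *)
pose t := node (fun _ : {i : idx y & idx (G i)} => node (fun i : False => match i return tree with end)).
have [z zE] := @family_node t (fun p => elt (projT2 p)).
have GE i : ext (G i) = F (elt i).
  by rewrite vsetE//; apply: Fset; apply/vinP; exists i.
exists z; rewrite zE; apply/seteqP; split=> x /=.
  move=> [[i j] _ <-] /=; exists (elt i); first by apply/vinP; exists i.
  by rewrite -GE; apply/vinP; exists j.
move=> [u /vinP[i ->]]; rewrite -GE => /vinP[j ->].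
by exists (existT _ i j).
Qed.

Lemma is_set_nat (F : nat -> V) : is_set (range F).
Proof.
exact: (@family_node (node (fun _ : nat => node (fun i : False => match i return tree with end)))).
Qed.

Lemma is_setU (A B : set V) : is_set A -> is_set B -> is_set (A `|` B).
Proof.
move=> [x <-] [y <-].
(* The unordered pair of [x] and [y] is the range of a sequence; its union is then taken. *)
have [z zE] := is_set_nat (fun n => if n == 0 then x else y).
have [u uE] : is_set (\bigcup_(w in ext z) ext w) by apply: is_set_bigcup => w _; exists w.
exists u; rewrite uE zE; apply/seteqP; split=> w /=.
  by move=> [_ [[|n] _ <-]]; [left|right].
by move=> [?|?]; [exists x|exists y] => //; [exists 0|exists 1].
Qed.

Lemma is_set1 x : is_set [set x].
Proof.
have [z zE] := is_set_nat (fun => x); exists z; rewrite zE.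
by apply/seteqP; split=> w /=; [move=> [_ _ <-]|move=> ->; exists 0].
Qed.

Lemma is_set_ext (x : V) : is_set x. Proof. by exists x. Qed.

Lemma is_setI (A : set V) (y : V) : is_set (A `&` y).
Proof. by apply: (@is_set_sub _ y) => x []. Qed.

Lemma is_setIl (A : set V) (y : V) : is_set (y `&` A).
Proof. by apply: (@is_set_sub _ y) => x []. Qed.

Lemma card_lePf {T} {U : pointedType} (A : set T) (B : set U) :
  A #<= B <-> exists2 f : T -> U, (forall x, A x -> B (f x)) &
    forall x y, A x -> A y -> f x = f y -> x = y.
Proof.
split=> [/pcard_leP/injfunPex[f fAB finj]|[f fAB finj]].
  by exists f => // x y Ax Ay; apply: finj; rewrite inE.
apply/pcard_leP/injfunPex; exists f => // x y; rewrite !inE; exact: finj.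
Qed.

(** * Ordinals *)

Lemma vin_irr (x : V) : ~ x ∈ x.
Proof. by elim/vin_ind: x => x IH xx; exact: (IH x xx xx). Qed.

Lemma vin_asym (x y : V) : x ∈ y -> ~ y ∈ x.
Proof.
elim/vin_ind: x y => x IH y xy yx; exact: (IH y yx x yx xy).
Qed.

Lemma ord_in (a b : V) : is_ordinal a -> b ∈ a -> is_ordinal b.
Proof.
move=> [ta ea] ba; split; first exact: ea.
by move=> c cb; apply: ea; exact: (ta b ba c cb).
Qed.

Lemma ord_trans (a b c : V) : is_ordinal a -> c ∈ b -> b ∈ a -> c ∈ a.
Proof. by move=> [ta _] cb ba; exact: (ta b ba c cb). Qed.

Lemma ord_total (a b : V) : is_ordinal a -> is_ordinal b ->
  [\/ a ∈ b, a = b | b ∈ a].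
Proof.
elim/vin_ind: a b => a IHa b; elim/vin_ind: b => b IHb oa ob.
have [|nab] := pselect (a ∈ b); first by constructor 1.
have [|nba] := pselect (b ∈ a); first by constructor 3.
suff -> : a = b by constructor 2.
apply: vext => c; split=> [ca|cb].
  have [//|cb|bc] := IHa c ca b (ord_in oa ca) ob.
    by case: nba; rewrite -cb.
  by case: nba; exact: ord_trans bc ca.
have [ac|ac|//] := IHb c cb oa (ord_in ob cb).
  by case: nab; exact: ord_trans ac cb.
by case: nab; rewrite ac.
Qed.

Lemma ord_leP (a b : V) : is_ordinal a -> is_ordinal b -> ord_le a b \/ b ∈ a.
Proof.
by move=> oa ob; have [?|?|?] := ord_total oa ob; [left; left|left; right|right].
Qed.

Lemma ord_le_sub (a b : V) : is_ordinal b -> ord_le a b -> a `<=` b.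
Proof. by move=> ob [ab|->] // c ca; exact: ord_trans ca ab. Qed.

Lemma ord_sub_le (a b : V) : is_ordinal a -> is_ordinal b -> a `<=` b -> ord_le a b.
Proof.
by move=> oa ob ab; have [//|/ab /vin_irr] := ord_leP oa ob.
Qed.

Lemma ord_lt_le (a b c : V) : is_ordinal c -> a ∈ b -> ord_le b c -> a ∈ c.
Proof. by move=> oc ab [bc|<-//]; exact: ord_trans ab bc. Qed.

Lemma ord_le_lt (a b c : V) : is_ordinal c -> ord_le a b -> b ∈ c -> a ∈ c.
Proof. by move=> oc [ab|->//] bc; exact: ord_trans ab bc. Qed.

Lemma ord_le_trans (a b c : V) : is_ordinal c -> ord_le a b -> ord_le b c -> ord_le a c.
Proof.
by move=> oc ab [bc|<-//]; left; exact: ord_le_lt bc.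
Qed.

Lemma ord_lt_nle (a b : V) : is_ordinal b -> a ∈ b -> ~ ord_le b a.
Proof. by move=> ob ab [/(vin_asym ab)|e] //; apply: (@vin_irr a); rewrite -{2}e. Qed.

Lemma ord_least (P : set V) (a : V) : is_ordinal a -> P a ->
  exists2 b, is_ordinal b /\ P b & ord_le b a /\ forall c, c ∈ b -> ~ P c.
Proof.
elim/vin_ind: a => a IH oa Pa.
have [[c [ca Pc]]|nc] := pselect (exists c, c ∈ a /\ P c).
  have [b [ob Pb] [bc minb]] := IH c ca (ord_in oa ca) Pc.
  by exists b => //; split=> //; left; exact: ord_le_lt ca.
by exists a => //; split; [right|move=> c ca Pc; apply: nc; exists c].
Qed.

Lemma leastP (P : set V) (a : V) : is_ordinal a -> P a ->
  [/\ is_ordinal (least P), P (least P), ord_le (least P) a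
    & forall c, c ∈ least P -> ~ P c].
Proof.
move=> oa Pa; rewrite /least; case: xgetP => [b _ [ob Pb mb]|nb].
  split=> //; have [//|/mb] := ord_leP ob oa; by [].
by have [b [ob Pb] [_ mb]] := ord_least oa Pa; case: (nb b).
Qed.

Lemma least_le (P : set V) (a : V) : is_ordinal a -> P a -> ord_le (least P) a.
Proof. by move=> oa Pa; have [] := leastP oa Pa. Qed.

Lemma ord_succE (a : V) : ext (ord_succ a) = ext a `|` [set a].
Proof. by apply: vsetE; apply: is_setU; [exists a|exact: is_set1]. Qed.

Lemma ord_succP (a b : V) : b ∈ ord_succ a <-> ord_le b a.
Proof. by change (ext (ord_succ a) b <-> ord_le b a); rewrite ord_succE. Qed.

Lemma ord_transitive (A : V) : (forall b, b ∈ A -> is_ordinal b) ->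
  transitive_set A -> is_ordinal A.
Proof. by move=> oA tA; split=> // b /oA[]. Qed.

Lemma ord_ord_succ (a : V) : is_ordinal a -> is_ordinal (ord_succ a).
Proof.
move=> oa; apply: ord_transitive => b /ord_succP ba; first by case: ba => [/(ord_in oa)|->].
by move=> c cb; apply/ord_succP; left; exact: ord_lt_le ba.
Qed.

Lemma ord_succ_lt (a : V) : a ∈ ord_succ a.
Proof. by apply/ord_succP; right. Qed.

Lemma ord_succ_le (a b : V) : is_ordinal b -> a ∈ b -> ord_le (ord_succ a) b.
Proof.
move=> ob ab; have oa := ord_in ob ab.
apply: ord_sub_le => //; first exact: ord_ord_succ.
by move=> c /ord_succP ca; exact: ord_le_lt ab.
Qed.

Lemma ord_empty : is_ordinal vempty.
Proof. by split=> b /vin_empty. Qed.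

Lemma limit_succ (a b : V) : limit_ordinal a -> b ∈ a -> ord_succ b ∈ a.
Proof.
move=> [oa _ la] ba; have [c ca bc] := la b ba.
by apply: (ord_le_lt oa _ ca); apply: (ord_succ_le (ord_in oa ca)).
Qed.

Lemma limit0 (a : V) : limit_ordinal a -> vempty ∈ a.
Proof.
move=> [oa a0 _]; have [//|e|/vin_empty//] := ord_total ord_empty oa.
by case: a0.
Qed.

Lemma max_ord (a b : V) : is_ordinal a -> is_ordinal b ->
  exists2 c, c = a \/ c = b & ord_le a c /\ ord_le b c.
Proof.
move=> oa ob; have [ab|ab|ba] := ord_total oa ob.
- by exists b; [right|split; [left|right]].
- by exists b; [right|split; right].
- by exists a; [left|split; [right|left]].
Qed.

(** * Well-founded recursion *)

Section Recursion.
Variables (D : Type) (R : D -> D -> Prop) (wfR : well_founded R).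
Variable G : D -> (D -> V) -> V.

(** [Fix] supplies values at the predecessors of [a] only; they are completed by [vempty], so that
    [G] can be written for total functions. *)
Definition restrict (a : D) (f : forall b, R b a -> V) (b : D) : V :=
  match pselect (R b a) with left p => f b p | right _ => vempty end.

Definition wfrec : D -> V := Fix wfR (fun _ => V) (fun a f => G a (restrict f)).

Lemma wfrecE a : wfrec a = G a (fun b => if pselect (R b a) then wfrec b else vempty).
Proof.
rewrite /wfrec Fix_eq.
  by congr G; apply: funext => b; rewrite /restrict; case: pselect.
move=> x f g fg; congr G; apply: funext => b; rewrite /restrict.
by case: pselect.
Qed.
End Recursion.

Lemma wfrecP (D : Type) (R : D -> D -> Prop) (wfR : well_founded R)
    (G : D -> (D -> V) -> V) :
  (forall a f g, (forall b, R b a -> f b = g b) -> G a f = G a g) ->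
  forall a, wfrec wfR G a = G a (wfrec wfR G).
Proof.
move=> Gext a; rewrite wfrecE; apply: Gext => b ba.
by case: pselect.
Qed.

(** * Order types through the Mostowski collapse *)

Section Collapse.
Variable x : V.

(** For a set [x] of ordinals and any ordinal [y], in [x] or not, this is the order type of the part
    of [x] below [y]. *)
Definition collapse : V -> V :=
  wfrec vin_wf (fun y f => vset [set f z | z in [set z | z ∈ x /\ z ∈ y]]).

Lemma is_set_collapse (f : V -> V) y : is_set [set f z | z in [set z | z ∈ x /\ z ∈ y]].
Proof.
have [w wE] : is_set [set z | z ∈ x /\ z ∈ y] by apply: (@is_set_sub _ x) => z [].
by rewrite -wE; exact: is_set_image.
Qed.

Lemma collapseP y u : u ∈ collapse y <-> exists z, [/\ z ∈ x, z ∈ y & u = collapse z].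
Proof.
rewrite {1}/collapse wfrecP; last first.
  by move=> a f g fg; congr vset; apply: eq_imagel => z [_ /fg].
rewrite (vsetP _ (is_set_collapse _ _)); split=> [[z [zx zy] <-]|[z [zx zy ->]]].
  by exists z.
by exists z.
Qed.

Hypothesis ox : forall y, y ∈ x -> is_ordinal y.

Lemma collapse_ord y : is_ordinal y -> is_ordinal (collapse y).
Proof.
elim/vin_ind: y => y IH oy; apply: ord_transitive => b /collapseP[z [zx zy ->]].
  by apply: IH => //; exact: ord_in zy.
move=> c /collapseP[w [wx wz ->]]; apply/collapseP; exists w; split=> //.
exact: ord_trans wz zy.
Qed.

Lemma collapse_lt y z : y ∈ x -> y ∈ z -> collapse y ∈ collapse z.
Proof. by move=> yx yz; apply/collapseP; exists y. Qed.

Lemma collapse_mono y z : y ∈ x -> z ∈ x -> (y ∈ z <-> collapse y ∈ collapse z).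
Proof.
move=> yx zx; split; first exact: collapse_lt.
move=> cyz; have [//|e|zy] := ord_total (ox yx) (ox zx).
  by rewrite e in cyz; have := vin_irr cyz.
by have := vin_asym (collapse_lt zx zy) cyz.
Qed.

Definition otype : V := vset [set collapse y | y in ext x].

Lemma otypeP u : u ∈ otype <-> exists2 y, y ∈ x & u = collapse y.
Proof.
rewrite (vsetP _ (is_set_image _ _)); split=> [[y yx <-]|[y yx ->]]; by exists y.
Qed.

Lemma otype_ord : is_ordinal otype.
Proof.
apply: ord_transitive => b /otypeP[y yx ->]; first exact/collapse_ord/ox.
by move=> c /collapseP[z [zx zy ->]]; apply/otypeP; exists z.
Qed.

(** By induction: the elements of [collapse y] are the [collapse z] for earlier [z], and these are
    at most [g z], hence below [g y]. *)
Lemma collapse_le (g : V -> V) (m : V) : is_ordinal m ->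
  (forall y, y ∈ x -> g y ∈ m) ->
  (forall y z, y ∈ x -> z ∈ x -> y ∈ z -> g y ∈ g z) ->
  forall y, y ∈ x -> ord_le (collapse y) (g y).
Proof.
move=> om gm gmono y; elim/vin_ind: y => y IH yx.
have og : is_ordinal (g y) by apply: ord_in om _; exact: gm.
apply: ord_sub_le => //; first exact/collapse_ord/ox.
move=> u /collapseP[z [zx zy ->]].
by apply: (ord_le_lt og (IH z zy zx)); exact: gmono.
Qed.
End Collapse.

Lemma collapse_bij (x : V) : (forall y, y ∈ x -> is_ordinal y) ->
  set_bij x (otype x) (collapse x).
Proof.
move=> ox; split=> [y yx|y z|u /otypeP[y yx ->]]; last by exists y.
  by apply/otypeP; exists y.
rewrite !inE => yx zx e; have [yz|//|zy] := ord_total (ox _ yx) (ox _ zx).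
  by have := collapse_lt yx yz; rewrite e => /vin_irr.
by have := collapse_lt zx zy; rewrite e => /vin_irr.
Qed.

(** As [r] is transitive and [f] is onto, every element of [f y] is some [f z] with [z] in [x] below
    [y]; so [f] obeys the recursion that defines [collapse]. *)
Lemma iso_collapse (x r : V) (f : V -> V) : (forall y, y ∈ x -> is_ordinal y) ->
  is_ordinal r -> set_bij x r f ->
  (forall y z, y ∈ x -> z ∈ x -> (y ∈ z <-> f y ∈ f z)) ->
  forall y, y ∈ x -> f y = collapse x y.
Proof.
move=> ox or_ [fr finj fs] fm y; elim/vin_ind: y => y IH yx.
apply: vext => u; rewrite collapseP; split=> [uf|[z [zx zy ->]]].
  have [z zx zu] := fs u (ord_trans or_ uf (fr y yx)).
  have zy : z ∈ y by apply/fm => //; rewrite zu.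
  by exists z; split=> //; rewrite -zu IH.
by rewrite -(IH z zy zx); apply/(fm z y zx yx).
Qed.

Lemma otp_otype (x : V) : (forall y, y ∈ x -> is_ordinal y) -> otp x = otype x.
Proof.
move=> ox.
have [|oo [f fb fm] _ _] := @leastP [set r : V | exists2 f : V -> V, set_bij x r f &
    forall y z, y ∈ x -> z ∈ x -> (y ∈ z <-> f y ∈ f z)] (otype x) (otype_ord ox).
  by exists (collapse x); [exact: collapse_bij|move=> y z yx zx; exact: collapse_mono].
rewrite -/(otp x) in oo fb *.
apply: vext => u; rewrite otypeP; split=> [uo|[y yx ->]].
  have [_ _ /(_ u uo)[y yx <-]] := fb; exists y => //.
  exact: (iso_collapse ox oo fb fm).
rewrite -(iso_collapse ox oo fb fm)//.
by case: fb => + _ _; apply.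
Qed.

(** * Cardinal arithmetic *)

Lemma is_set_le (A : set V) (y : V) : A #<= y -> is_set A.
Proof.
move=> /pcard_surjP[g gs]; have [z zE] := is_set_image g y.
by apply: (@is_set_sub _ z) => x Ax; rewrite zE; exact: gs.
Qed.

Lemma card_leX {T T'} {U U' : pointedType} (A : set T) (A' : set T') (B : set U) (B' : set U') :
  A #<= B -> A' #<= B' -> A `*` A' #<= B `*` B'.
Proof.
move=> /card_lePf[f fAB finj] /card_lePf[g gAB ginj]; apply/card_lePf.
exists (fun p => (f p.1, g p.2)) => [p [] /fAB ? /gAB ?|[x x'] [y y'] [] /= Ax Ax' [] /= Ay Ay' []].
  by split.
by move=> /(finj _ _ Ax Ay) -> /(ginj _ _ Ax' Ay') ->.
Qed.

Lemma infinite_card_le {T U} (A : set T) (B : set U) :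
  A #<= B -> infinite_set A -> infinite_set B.
Proof. by move=> AB iA /(card_le_finite AB). Qed.

Lemma ord_card_le (a b : V) : is_ordinal b -> ord_le a b -> a #<= b.
Proof. by move=> ob /(ord_le_sub ob) /subset_card_le. Qed.

Lemma infinite_succ_le (b : V) : infinite_set b -> ord_succ b #<= b.
Proof.
move=> /infiniteP /card_lePf[f fb finj].
(* Hilbert's hotel: the new point [b] goes to [f 0], each [f n] moves to [f n.+1], all other points
   stay. *)
apply/card_lePf; exists (fun y => if pselect (y = b) then f 0 else
  match pselect (exists n, y = f n) with
  | left p => f (sval (cid p)).+1 | right _ => y end).
  move=> y /ord_succP yb; case: (pselect (y = b)) => [?|nyb]; first exact: fb.
  by case: (pselect (exists n, y = f n)) => [?|?]; [exact: fb|case: yb].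
have fi m n : f m = f n -> m = n by exact: finj.
move=> y z _ _; case: (pselect (y = b)) => yb; case: (pselect (z = b)) => zb /=.
- by rewrite yb zb.
- by case: (pselect (exists n, z = f n)) => [p /fi //|np e]; case: np; exists 0.
- by case: (pselect (exists n, y = f n)) => [p /fi //|np e]; case: np; exists 0.
case: (pselect (exists n, y = f n)) => p; case: (pselect (exists n, z = f n)) => q //.
- by move=> /fi[e]; rewrite (svalP (cid p)) (svalP (cid q)) e.
- by move=> e; case: q; exists (sval (cid p)).+1.
- by move=> e; case: p; exists (sval (cid q)).+1.
Qed.

Lemma infinite_cardinal_limit (k : V) :
  is_cardinal k -> infinite_set k -> limit_ordinal k.
Proof.
move=> [ok ck] ik; split=> //.
  by move=> k0; apply: ik; rewrite k0; have [] := is_set0; 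
     rewrite (_ : ext vempty = set0) //; apply/seteqP; split=> x // /vin_empty.
move=> b bk; exists (ord_succ b); last exact: ord_succ_lt.
have [//|e] := ord_succ_le ok bk; rewrite -e in ik ck *.
have ib : infinite_set b.
  move=> fb; apply: ik; rewrite ord_succE finite_setU; split=> //; exact: finite_set1.
have /negP[] := ck _ (ord_succ_lt b).
rewrite card_eq_le (infinite_succ_le ib) andbT; apply: subset_card_le => x xb.
by apply/ord_succP; left.
Qed.

Section Goedel.
(** Gödel's well-ordering of pairs of ordinals: by maximum, then
    lexicographically. *)
Definition pair_max (p : V * V) : V := vset (p.1 `|` p.2).

Definition pair_lt (p q : V * V) : Prop :=
  pair_max p ∈ pair_max q \/ (pair_max p = pair_max q /\
    (p.1 ∈ q.1 \/ (p.1 = q.1 /\ p.2 ∈ q.2))).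

Lemma pair_lt_wf : well_founded pair_lt.
Proof.
suff H m x y : pair_max (x, y) = m -> Acc pair_lt (x, y) by move=> [x y]; exact: H.
elim/vin_ind: m x y => m IHm; elim/vin_ind => x IHx; elim/vin_ind => y IHy e.
constructor=> -[x' y'] [lt_m|[e' lex]].
  by rewrite e in lt_m; exact: IHm lt_m x' y' erefl.
rewrite e in e'; case: lex => /= [x'x|[e1 y'y]]; first exact: IHx x'x y' e'.
by subst x'; exact: IHy y'y e'.
Qed.

Lemma pair_maxP (p : V * V) : is_ordinal p.1 -> is_ordinal p.2 ->
  [/\ pair_max p = p.1 \/ pair_max p = p.2, ord_le p.1 (pair_max p)
    & ord_le p.2 (pair_max p)].
Proof.
case: p => x y /= ox oy; have [z ze [xz yz]] := max_ord ox oy.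
have oz : is_ordinal z by case: ze => ->.
have -> : pair_max (x, y) = z; last by split.
apply: vext => u; rewrite vsetP /=; last by apply: is_setU; exact: is_set_ext.
split=> [[ux|uy]|uz]; [exact: ord_lt_le ux xz|exact: ord_lt_le uy yz|].
by case: ze => <-; [left|right].
Qed.

Variable a : V.
Hypothesis oa : is_ordinal a.

Let dom (p : V * V) := p.1 ∈ a /\ p.2 ∈ a.

Let dom_ord p : dom p -> is_ordinal p.1 /\ is_ordinal p.2.
Proof. by move=> [/(ord_in oa) ? /(ord_in oa)]. Qed.

Let dom_max p : dom p -> pair_max p ∈ a.
Proof. by move=> pd; have [o1 o2] := dom_ord pd; have [[]-> _ _] := pair_maxP o1 o2; case: pd. Qed.

Let pair_lt_total p q : dom p -> dom q -> [\/ pair_lt p q, p = q | pair_lt q p].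
Proof.
move=> dp dq; have [op1 op2] := dom_ord dp; have [oq1 oq2] := dom_ord dq.
have [?|e|?] := ord_total (ord_in oa (dom_max dp)) (ord_in oa (dom_max dq)).
- by constructor 1; left.
- have [?|e1|?] := ord_total op1 oq1.
  + by constructor 1; right; split=> //; left.
  + have [?|e2|?] := ord_total op2 oq2.
    * by constructor 1; right; split=> //; right.
    * by constructor 2; case: p q e1 e2 {dp dq op1 op2 oq1 oq2 e} => ? ? [? ?] /= -> ->.
    * by constructor 3; right; split=> //; right.
  + by constructor 3; right; split=> //; left.
- by constructor 3; left.
Qed.

Let pair_lt_trans p q r : dom p -> dom q -> dom r ->
  pair_lt p q -> pair_lt q r -> pair_lt p r.
Proof.
move=> dp dq dr; have or_ := ord_in oa (dom_max dr).
have [or1 or2] := dom_ord dr.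
move=> [pq|[e pq]] [qr|[e' qr]].
- by left; exact: ord_trans qr.
- by left; rewrite -e'.
- by left; rewrite e.
- right; rewrite e; split=> //.
  case: pq => [pq|[e1 pq]]; case: qr => [qr|[e1' qr]].
  + by left; exact: ord_trans qr.
  + by left; rewrite -e1'.
  + by left; rewrite e1.
  + by right; rewrite e1; split=> //; exact: ord_trans qr.
Qed.

Let code_step (p : V * V) (f : V * V -> V) : V :=
  vset [set f q | q in [set q | dom q /\ pair_lt q p]].

(** The ordinal position of a pair in the well-ordering of the square of [a]. *)
Definition pair_code : V * V -> V := wfrec pair_lt_wf code_step.

Let code_small (f : V * V -> V) p :
  is_set [set f q | q in [set q | dom q /\ pair_lt q p]].
Proof.
have [z zE] : is_set (\bigcup_(x in ext a) [set f (x, y) | y in ext a]).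
  by apply: is_set_bigcup => x _; exact: is_set_image.
apply: (@is_set_sub _ z); rewrite zE => _ [[x y] [[xa ya] _] <-].
by exists x => //; exists y.
Qed.

Let pair_codeP p u : u ∈ pair_code p <->
  exists q, [/\ dom q, pair_lt q p & u = pair_code q].
Proof.
rewrite {1}/pair_code wfrecP; last first.
  by move=> q f g fg; congr vset; apply: eq_imagel => z [_ /fg].
rewrite (vsetP _ (code_small _ _)); split=> [[q [dq qp] <-]|[q [dq qp ->]]]; by exists q.
Qed.

Let pair_code_ord p : dom p -> is_ordinal (pair_code p).
Proof.
elim/(well_founded_ind pair_lt_wf): p => p IH dp.
apply: ord_transitive => b /pair_codeP[q [dq qp ->]]; first exact: IH.
move=> c /pair_codeP[r [dr rq ->]]; apply/pair_codeP; exists r; split=> //.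
exact: pair_lt_trans rq qp.
Qed.

Lemma pair_code_inj p q : p.1 ∈ a -> p.2 ∈ a -> q.1 ∈ a -> q.2 ∈ a ->
  pair_code p = pair_code q -> p = q.
Proof.
move=> p1 p2 q1 q2 e; have [pq|//|qp] := @pair_lt_total p q (conj p1 p2) (conj q1 q2).
  by case: (@vin_irr (pair_code p)); rewrite {2}e; apply/pair_codeP; exists p.
by case: (@vin_irr (pair_code q)); rewrite -{2}e; apply/pair_codeP; exists q.
Qed.

Lemma pair_code_ordinal p : p.1 ∈ a -> p.2 ∈ a -> is_ordinal (pair_code p).
Proof. by move=> p1 p2; exact: pair_code_ord. Qed.

(** With [m] the maximum of [p], all pairs before [p] have both coordinates at most [m]. *)
Lemma pair_code_card p : p.1 ∈ a -> p.2 ∈ a ->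
  exists2 m, m ∈ a & pair_code p #<= ext (ord_succ m) `*` ext (ord_succ m).
Proof.
move=> p1 p2; exists (pair_max p); first exact: dom_max.
apply: (@card_le_trans _ _ _ (pair_code @` (ext (ord_succ (pair_max p)) `*` ext (ord_succ (pair_max p)))));
  last exact: card_image_le.
apply: subset_card_le => u /pair_codeP[q [dq qp ->]]; exists q => //.
have om := ord_in oa (dom_max (conj p1 p2)).
have [oq1 oq2] := dom_ord dq; have [_ q1 q2] := pair_maxP oq1 oq2.
have qm : ord_le (pair_max q) (pair_max p) by case: qp => [?|[-> _]]; [left|right].
by split; apply/ord_succP; apply: (ord_le_trans om) qm.
Qed.
End Goedel.

(** Hessenberg's theorem, by induction. If [a] is not a cardinal, a smaller equinumerous ordinal
    does the work. If it is, all codes lie below [a]: a code at or above [a] would embed [a] in the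
    square of some [m + 1] below [a], which is finite or, by induction, of the size of [m + 1]. *)
Theorem infinite_square_le (a : V) : is_ordinal a -> infinite_set a ->
  ext a `*` ext a #<= a.
Proof.
elim/vin_ind: a => a IH oa ia.
have [ca|] := pselect (is_cardinal a); last first.
  move=> nca; have [b [ba bea]] : exists b, b ∈ a /\ b #= a.
    apply: contrapT => nb; apply: nca; split=> // b ba; apply/negP => be.
    by apply: nb; exists b.
  move: bea; rewrite card_eq_le => /andP[ble ale].
  apply: card_le_trans (card_leX ale ale) _.
  apply: card_le_trans ble; apply: IH => //; first exact: ord_in ba.
  exact: infinite_card_le ia.
have la := infinite_cardinal_limit ca ia.
apply/card_lePf; exists (pair_code a) => [p [p1 p2]|p q [p1 p2] [q1 q2]]; last exact: pair_code_inj.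
have [m ma pm] := pair_code_card oa p1 p2.
have oc := pair_code_ordinal oa p1 p2.
have [ac|//] := ord_leP oa oc; exfalso.
have {}pm := card_le_trans (ord_card_le oc ac) pm.
have sa := limit_succ la ma.
have [fs|is_] := pselect (finite_set (ord_succ m)).
  by apply: ia; apply: (card_le_finite pm); exact: finite_setX.
have {}pm := card_le_trans pm (IH _ sa (ord_in oa sa) is_).
have /negP[] := ca.2 _ sa; rewrite card_eq_le pm andbT.
by apply: ord_card_le => //; left.
Qed.

(** * Unions, products and finite sequences of at most [K] objects *)

Section Absorption.
Variable K : V.
Hypotheses (oK : is_ordinal K) (iK : infinite_set K).

Lemma countable_le {T} (A : set T) : countable A -> A #<= K.
Proof. by move=> /card_le_trans; apply; exact/infiniteP. Qed.

Lemma setX_le {T T'} (A : set T) (B : set T') : A #<= K -> B #<= K -> A `*` B #<= K.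
Proof.
by move=> AK BK; apply: card_le_trans (card_leX AK BK) (infinite_square_le oK iK).
Qed.

Lemma bigcup_le {I T} (D : set I) (F : I -> set T) :
  D #<= K -> (forall i, D i -> F i #<= K) -> \bigcup_(i in D) F i #<= K.
Proof.
move=> /card_lePf[d dK dinj] FK.
have /choice[f fP] : forall i, exists f : T -> V, D i ->
    (forall x, F i x -> f x ∈ K) /\ forall x y, F i x -> F i y -> f x = f y -> x = y.
  move=> i; have [Di|nDi] := pselect (D i); last by exists (fun => vempty).
  by have /card_lePf[g gK ginj] := FK i Di; exists g.
pose S : set (I * T) := [set p | D p.1 /\ F p.1 p.2].
have -> : \bigcup_(i in D) F i = snd @` S.
  apply/seteqP; split=> [x [i Di Fx]|_ [[i x] [Di Fx] <-]]; last by exists i.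
  by exists (i, x).
apply: card_le_trans (card_image_le _ _) _.
apply: card_le_trans (infinite_square_le oK iK).
apply/card_lePf; exists (fun p => (d p.1, f p.1 p.2)).
  by move=> [i x] [/= Di Fx]; split; [exact: dK|exact: (fP i Di).1].
move=> [i x] [j y] [/= Di Fx] [/= Dj Fy] [/(dinj _ _ Di Dj) ij]; subst j.
by move/((fP i Di).2 _ _ Fx Fy) => ->.
Qed.

Lemma setU_le {T} (A B : set T) : A #<= K -> B #<= K -> A `|` B #<= K.
Proof.
move=> AK BK; have -> : A `|` B = \bigcup_(b in [set: bool]) (if b then A else B).
  apply/seteqP; split=> [x [Ax|Bx]|x [[] _]]; [by exists true|by exists false|by left|by right].
by apply: bigcup_le => [|[] _//]; exact/countable_le/countableP.
Qed.

Lemma set1_le {T} (x : T) : [set x] #<= K.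
Proof. exact/countable_le/countable1. Qed.

Lemma seq_le {T : eqType} (A : set T) : A #<= K ->
  [set s : seq T | forall x, x \in s -> A x] #<= K.
Proof.
move=> AK; set S := (X in X #<= _).
have -> : S = \bigcup_(n in [set: nat]) [set s | S s /\ size s = n].
  by apply/seteqP; split=> [s Ss|s [n _ []//]]; exists (size s).
apply: bigcup_le => [|n _]; first exact/countable_le/countableP.
elim: n => [|n IH].
  apply: card_le_trans (set1_le (@nil T)); apply: subset_card_le => s [_].
  by case: s.
have -> : [set s | S s /\ size s = n.+1] =
    (fun p => p.1 :: p.2) @` (A `*` [set s | S s /\ size s = n]).
  apply/seteqP; split=> [[|x s] [Ss //= [sn]]|_ [[x s] [/= Ax [Ss sn]] <-]].
    exists (x, s) => //; split=> /=; first by apply: Ss; rewrite mem_head.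
    by split=> // y ys; apply: Ss; rewrite inE ys orbT.
  split=> /=; last by rewrite sn.
  by move=> y; rewrite inE => /orP[/eqP->//|]; exact: Ss.
by apply: card_le_trans (card_image_le _ _) _; exact: setX_le.
Qed.
End Absorption.

(** * Cofinality and successor cardinals *)

Lemma card_ltE (A B : set V) : A #< B <-> A #<= B /\ ~ (B #<= A).
Proof. by split=> [/andP[? /negP]|[? ?]] //; apply/andP; split=> //; apply/negP. Qed.

Lemma ord_embed_le (a m : V) (g : V -> V) : is_ordinal a -> is_ordinal m ->
  (forall y, y ∈ a -> g y ∈ m) ->
  (forall y z, y ∈ a -> z ∈ a -> y ∈ z -> g y ∈ g z) -> ord_le a m.
Proof.
move=> oa om gm gmono; apply: ord_sub_le => // y ya.
suff yg : ord_le y (g y) by exact: ord_le_lt om yg (gm y ya).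
elim/vin_ind: y ya => y IH ya.
have og : is_ordinal (g y) by exact: ord_in om (gm y ya).
apply: ord_sub_le => //; first exact: ord_in oa ya.
move=> z zy; have za := ord_trans oa zy ya.
exact: ord_le_lt og (IH z zy za) (gmono z y za ya zy).
Qed.

Lemma otype_le (x m : V) (g : V -> V) : (forall y, y ∈ x -> is_ordinal y) ->
  is_ordinal m -> (forall y, y ∈ x -> g y ∈ m) ->
  (forall y z, y ∈ x -> z ∈ x -> y ∈ z -> g y ∈ g z) -> ord_le (otype x) m.
Proof.
move=> ox om gm gmono; apply: ord_sub_le => //; first exact: otype_ord.
move=> u /otypeP[y yx ->]; apply: (ord_le_lt om _ (gm y yx)).
exact: (collapse_le ox om gm gmono).
Qed.

Lemma otype_card (x : V) : (forall y, y ∈ x -> is_ordinal y) -> otype x #= x.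
Proof.
by move=> ox; rewrite card_eq_sym; apply/card_set_bijP; exists (collapse x); exact: collapse_bij.
Qed.

Lemma cardinal_card_le (k a : V) : is_cardinal k -> is_ordinal a ->
  k #<= a -> ord_le k a.
Proof.
move=> [ok ck] oa ka; have [//|ak] := ord_leP ok oa.
have /negP[] := ck a ak; rewrite card_eq_le ka andbT.
by apply: ord_card_le => //; left.
Qed.

(** From left to right, [A] is copied into [k]; the order type of the copy is an ordinal at most [k]
    of the size of [A], and it cannot be [k]. *)
Lemma card_lt_cardinal (k : V) (A : set V) : is_cardinal k ->
  (A #< k <-> exists2 b, b ∈ k & A #<= b).
Proof.
move=> ck; have ok := ck.1; rewrite card_ltE; split=> [[Ak kA]|[b bk Ab]]; last first.
  split; first by apply: card_le_trans Ab _; apply: ord_card_le => //; left.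
  move=> kA; have kb := cardinal_card_le ck (ord_in ok bk) (card_le_trans kA Ab).
  exact: ord_lt_nle ok bk kb.
have [f fk finj] := (card_lePf A k).1 Ak.
have [x xE] : is_set (f @` A) by apply: (@is_set_sub _ k) => _ [y Ay <-]; exact: fk.
have xk : x `<=` k by rewrite xE => _ [y Ay <-]; exact: fk.
have ox y : y ∈ x -> is_ordinal y by move=> /xk; exact: ord_in.
have := otype_card ox; rewrite card_eq_le => /andP[rx xr].
have Ax : A #<= x by rewrite xE; apply/card_lePf; exists f => // y Ay; exists y.
have [rk|rk] := @otype_le x k id ox ok xk (fun _ _ _ _ => id).
  by exists (otype x) => //; exact: card_le_trans xr.
case: kA; rewrite -rk; apply: card_le_trans rx _.
by rewrite xE; exact: card_image_le.
Qed.

Lemma ord_cardinal (a : V) : is_ordinal a ->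
  exists2 m, is_cardinal m & ord_le m a /\ m #= a.
Proof.
move=> oa; have [m [om ma] [le_ma mmin]] := @ord_least [set m : V | m #= a] a oa (card_eqxx _).
exists m => //; split=> // b bm; apply/negP => /card_eq_trans/(_ ma).
exact: mmin.
Qed.

(** If every ordinal embeds in [x], it can be recovered from the relation that the embedding induces
    on the indices of [x]. These relations are few enough to index a tree, so the ordinals form a
    set, against Burali-Forti. *)
Lemma Hartogs (x : V) : exists2 a, is_ordinal a & ~ (a #<= x).
Proof.
apply: contrapT => nx.
have {nx} /choice[f fP] : forall a : V, exists f : V -> V, is_ordinal a ->
    (forall y, y ∈ a -> f y ∈ x) /\ forall y z, y ∈ a -> z ∈ a -> f y = f z -> y = z.
  move=> a; have [oa|noa] := pselect (is_ordinal a); last by exists id.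
  have /card_lePf[g gx ginj] : a #<= x.
    by apply: contrapT => nax; apply: nx; exists a.
  by exists g.
(* The reflexive order is used because its diagonal records which indices are hit; with the strict
   order, 0 and 1 would induce the same relation. *)
pose rel a (i j : idx x) := exists y z,
  [/\ y ∈ a, z ∈ a, ord_le y z, elt i = f a y & elt j = f a z].
have rel_le a b : is_ordinal a -> is_ordinal b -> rel a = rel b -> ord_le a b.
  move=> oa ob ab.
  have H y z : y ∈ a -> z ∈ a -> ord_le y z -> exists u v,
      [/\ u ∈ b, v ∈ b, ord_le u v, f a y = f b u & f a z = f b v].
    move=> ya za yz.
    have /vinP[i iE] := (fP a oa).1 y ya; have /vinP[j jE] := (fP a oa).1 z za.
    have : rel a i j by exists y, z.
    by rewrite ab => -[u [v [ub vb uv iu jv]]]; exists u, v; rewrite iE jE.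
  have /choice[g gP] : forall y, exists u, y ∈ a -> u ∈ b /\ f a y = f b u.
    move=> y; have [ya|nya] := pselect (y ∈ a); last by exists y.
    by have [u [_ [ub _ _ e _]]] := H y y ya ya (or_intror erefl); exists u.
  apply: (ord_embed_le oa ob (g := g)) => [y /gP[]//|y z ya za yz].
  have [gyb gy] := gP y ya; have [gzb gz] := gP z za.
  have [u [v [ub vb uv yu zv]]] := H y z ya za (or_introl yz).
  have -> : g y = u by apply: (fP b ob).2 => //; rewrite -gy.
  have -> : g z = v by apply: (fP b ob).2 => //; rewrite -gz.
  case: uv => // uv; case: (@vin_irr z); rewrite -{1}(_ : y = z)//.
  by apply: (fP a oa).2; rewrite // yu uv.
pose code (R : idx x -> idx x -> Prop) := xget vempty [set a | is_ordinal a /\ rel a = R].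
have [w wE] := @family_node (node (fun _ : idx x -> idx x -> Prop => vtree x)) code.
have ordw : [set a | is_ordinal a] `<=` w.
  rewrite wE => a oa; exists (rel a) => //; rewrite /code.
  case: xgetP => [b _ [ob ba]|/(_ a)[]//].
  have [ab|//] := rel_le a b oa ob (esym ba).
  by have /(ord_lt_nle ob ab) := rel_le b a ob oa ba.
have so := is_set_sub ordw.
have oo : is_ordinal (vset [set a | is_ordinal a]).
  apply: ord_transitive => b /(vsetP _ so)//= ob c cb.
  by apply/(vsetP _ so); exact: ord_in cb.
by apply: (@vin_irr (vset [set a | is_ordinal a])); apply/(vsetP _ so).
Qed.

Lemma succ_cardP (l : V) : is_cardinal l -> infinite_set l ->
  [/\ is_cardinal (succ_card l), infinite_set (succ_card l), l ∈ succ_card l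
    & forall A : set V, A #< succ_card l <-> A #<= l].
Proof.
move=> cl il; have [a oa al] := Hartogs l.
have la : l #< a.
  apply/card_ltE; split=> //; have [/(ord_card_le oa)//|ale] := ord_leP cl.1 oa.
  by case: al; apply: ord_card_le; [exact: cl.1|left].
have [oK lK _ minK] := @leastP [set a : V | l #< a] a oa la.
rewrite -/(succ_card l) in oK lK minK.
have Kle b : b ∈ succ_card l -> b #<= l.
  move=> bK; apply: contrapT => nbl; apply: (minK b bK); apply/card_ltE; split=> //.
  have ob := ord_in oK bK; have [/(ord_card_le ob)//|ble] := ord_leP cl.1 ob.
  by case: nbl; apply: ord_card_le; [exact: cl.1|left].
have cK : is_cardinal (succ_card l).
  split=> // b bK; apply/negP; rewrite card_eq_le => /andP[_ Kb].
  by move/card_ltE: lK => [_]; apply; exact: card_le_trans (Kle b bK).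
have lK' : l ∈ succ_card l.
  have [//|e|Kl] := ord_total cl.1 oK; first by move/card_ltE: lK => [_]; rewrite -{1}e => -[].
  by move/card_ltE: lK => [_ []]; apply: ord_card_le; [exact: cl.1|left].
split=> //; first by apply: infinite_card_le il; move/card_ltE: lK => [].
move=> A; split=> [/(card_lt_cardinal _ cK)[b bK Ab]|Al].
  exact: card_le_trans Ab (Kle b bK).
by apply/(card_lt_cardinal _ cK); exists l.
Qed.

(** * Cofinality *)

Definition cofinal_map (m a : V) (f : V -> V) :=
  (forall xi, xi ∈ m -> f xi ∈ a) /\
  forall b, b ∈ a -> exists2 xi, xi ∈ m & ord_le b (f xi).

Lemma cfP (a : V) : is_ordinal a ->
  [/\ is_ordinal (cf a), exists f, cofinal_map (cf a) a f, ord_le (cf a) a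
    & forall m f, is_ordinal m -> cofinal_map m a f -> ord_le (cf a) m].
Proof.
move=> oa; pose P := [set m | exists2 f : V -> V, (forall xi, xi ∈ m -> f xi ∈ a) &
    forall b, b ∈ a -> exists2 xi, xi ∈ m & ord_le b (f xi)].
have [|oc [f f1 f2] ca _] := @leastP P a oa.
  by exists id => // b ba; exists b => //; right.
split=> //; first by exists f.
by move=> m g om [g1 g2]; apply: (@least_le P) => //; exists g.
Qed.

Lemma cf_bounded {T : pointedType} (a n : V) (D : set T) (f : T -> V) : limit_ordinal a ->
  n ∈ cf a -> D #<= n -> (forall i, D i -> f i ∈ a) ->
  exists2 b, b ∈ a & forall i, D i -> f i ∈ b.
Proof.
move=> la nc /pcard_surjP[g gD] fa; have oa : is_ordinal a by case: la.
have [oc _ _ cmin] := cfP oa; apply: contrapT => nb.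
apply: (ord_lt_nle oc nc).
(* The surjection [g] of [n] onto [D] may also take values outside [D], where [f] is not controlled.
   Were [f] unbounded on [D], this [h] would be cofinal in [a] from [n], below [cf a]. *)
pose h xi := if pselect (D (g xi)) then f (g xi) else vempty.
apply: (cmin n h); first exact: ord_in nc.
split=> [xi _|b ba]; first by rewrite /h; case: (pselect (D (g xi))) => [/fa//|?]; exact: limit0.
apply: contrapT => nxi; apply: nb; exists b => // i Di.
have [xi xin gi] := gD i Di.
have [bf|//] := ord_leP (ord_in oa ba) (ord_in oa (fa i Di)).
by case: nxi; exists xi => //; rewrite /h gi; case: pselect.
Qed.

Lemma cf_cardinal (a : V) : is_ordinal a -> is_cardinal (cf a).
Proof.
move=> oa; have [oc [f [fa fcof]] _ cmin] := cfP oa; split=> // b bc; apply/negP.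
move=> /card_set_bijP[g [gb _ gs]].
apply: (ord_lt_nle oc bc); apply: (cmin b (f \o g)); first exact: ord_in bc.
split=> [xi xib|c ca]; first by apply: fa; exact: gb.
by have [xi xic cf_] := fcof c ca; have [y yb e] := gs xi xic; exists y => //=; rewrite e.
Qed.

Lemma finite_bounded {T : eqType} (a : V) (s : seq T) (f : T -> V) : limit_ordinal a ->
  (forall i, i \in s -> f i ∈ a) -> exists2 b, b ∈ a & forall i, i \in s -> f i ∈ b.
Proof.
move=> la; have oa : is_ordinal a by case: la.
elim: s => [|i s IH] fs; first by exists vempty => //; exact: limit0.
have [j js|b ba bs] := IH; first by apply: fs; rewrite inE js orbT.
have fia := fs i (mem_head _ _).
have [c ce [ic bc]] := max_ord (ord_in oa fia) (ord_in oa ba).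
have ca : c ∈ a by case: ce => ->.
exists (ord_succ c); first exact: limit_succ.
move=> j; rewrite inE => /orP[/eqP->|/bs fb]; apply/ord_succP => //.
by left; exact: ord_lt_le (ord_in oa ca) fb bc.
Qed.

Lemma cf_infinite (a : V) : limit_ordinal a -> infinite_set (cf a).
Proof.
move=> la; have oa : is_ordinal a by case: la.
have [oc [f [fa fcof]] _ _] := cfP oa => /finite_seqP[s sE].
have [xi|b ba fb] := finite_bounded (s := s) (f := f) la.
  by move=> xis; apply: fa; have : ext (cf a) xi by rewrite sE.
have [xi xic] := fcof b ba; apply: ord_lt_nle (ord_in oa ba) _.
by apply: fb; change ([set` s] xi); rewrite -sE.
Qed.

(** A cofinal map [f] on [cf a] need not be increasing, so it is replaced by an [h] with [h xi]
    above all values of [f] up to [xi]. Then [h] composed with a cofinal map from [cf (cf a)] to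
    [cf a] is cofinal in [a]. *)
Lemma cf_cf (a : V) : limit_ordinal a -> cf (cf a) = cf a.
Proof.
move=> la; have oa : is_ordinal a by case: la.
have [oc [f [fa fcof]] _ cmin] := cfP oa.
have lc : limit_ordinal (cf a).
  exact: infinite_cardinal_limit (cf_cardinal oa) (cf_infinite la).
have [on [g [gc gcof]] nc _] := cfP oc.
case: nc => // nc; case: (ord_lt_nle oc nc).
have /choice[h hP] : forall xi, exists b, xi ∈ cf a ->
    b ∈ a /\ forall eta, ord_le eta xi -> f eta ∈ b.
  move=> xi; have [xic|nxi] := pselect (xi ∈ cf a); last by exists vempty.
  have [eta|b ba fb] := cf_bounded (D := ord_succ xi) (f := f) la (limit_succ lc xic) (card_lexx _).
    by move=> /ord_succP eta_xi; apply: fa; exact: ord_le_lt xic.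
  by exists b => _; split=> // eta eta_xi; apply: fb; exact/ord_succP.
apply: (cmin _ (h \o g)) => //; split=> [xi /gc /hP[]//|b ba].
have [eta eta_c b_eta] := fcof b ba; have [xi xin eta_xi] := gcof eta eta_c.
exists xi => //=; have [ha hb] := hP _ (gc xi xin).
by left; apply: ord_le_lt (ord_in oa ha) b_eta (hb eta eta_xi).
Qed.

Lemma cf_regular (a : V) : limit_ordinal a -> regular (cf a).
Proof.
move=> la; split; last exact: cf_cf; last exact: cf_infinite.
by apply: cf_cardinal; case: la.
Qed.

Lemma regular_limit (k : V) : regular k -> limit_ordinal k.
Proof. by case=> ck ik _; exact: infinite_cardinal_limit. Qed.

(** By regularity one [c] below [k] bounds the number of sets and all their sizes, so the union is
    finite or of size at most [c]. *)
Lemma regular_bigcup (k : V) (z : set V) (F : V -> set V) :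
  regular k -> z #< k -> (forall y, z y -> F y #< k) -> ~ (k #<= \bigcup_(y in z) F y).
Proof.
move=> rk zk Fk; have [ck ik cfk] := rk; have lk := regular_limit rk.
have ok := ck.1.
have [m mk zm] := (card_lt_cardinal z ck).1 zk.
have /choice[f fP] : forall y, exists b, z y -> b ∈ k /\ F y #<= b.
  move=> y; have [zy|nzy] := pselect (z y); last by exists vempty.
  by have [b bk Fb] := (card_lt_cardinal (F y) ck).1 (Fk y zy); exists b.
have m_cf : m ∈ cf k by rewrite cfk.
have [y /fP[]//|b bk fb] := cf_bounded (f := f) lk m_cf zm.
have [c ce [mc bc]] := max_ord (ord_in ok mk) (ord_in ok bk).
have cink : c ∈ k by case: ce => ->.
have oc := ord_in ok cink.
have Fc y : z y -> F y #<= c.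
  move=> zy; apply: card_le_trans (fP y zy).2 _; apply: ord_card_le => //.
  by left; exact: ord_lt_le (fb y zy) bc.
have zc : z #<= c by apply: card_le_trans zm _; exact: ord_card_le.
move=> kle; have [fc|ic] := pselect (finite_set c).
  apply: ik; apply: card_le_finite kle _; apply: bigcup_finite => [|y zy].
    exact: card_le_finite zc fc.
  exact: card_le_finite (Fc y zy) fc.
have kc := card_le_trans kle (bigcup_le oc ic zc Fc).
exact: ord_lt_nle ok cink (cardinal_card_le ck oc kc).
Qed.

(** [x] consists of the record values of a cofinal map [f] on [cf d], and [g] returns the place of a
    record. The clause on [xi] serves to show that bounded parts of [x] have size less than
    [cf d]. *)
Lemma cofinal_set (d : V) : limit_ordinal d -> exists (x : V) (g : V -> V),
  [/\ x `<=` d, forall b, b ∈ d -> exists2 y, y ∈ x & ord_le b y,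
      forall y, y ∈ x -> g y ∈ cf d,
      forall y z, y ∈ x -> z ∈ x -> y ∈ z -> g y ∈ g z
    & forall b, b ∈ d -> exists2 xi, xi ∈ cf d &
        forall y, y ∈ x -> y ∈ b -> g y ∈ xi] /\ x #= cf d.
Proof.
move=> ld; have od : is_ordinal d by case: ld.
have [oc [f [fd fcof]] _ cmin] := cfP od.
pose X := [set xi | xi ∈ cf d /\ forall eta, eta ∈ xi -> f eta ∈ f xi].
have [x xE] : is_set (f @` X).
  by apply: (@is_set_sub _ d) => _ [xi [xic _] <-]; exact: fd.
have xP y : y ∈ x <-> (f @` X) y by rewrite -xE.
(* The first place where [f] reaches [b] is a record, since all earlier values are below [b]. *)
have recX b : b ∈ d -> exists2 xi, X xi & ord_le b (f xi).
  move=> bd; have [xi0 xi0c bxi0] := fcof b bd.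
  have [xi [oxi [xic bxi]] [_ xmin]] := @ord_least [set xi | xi ∈ cf d /\ ord_le b (f xi)] xi0
    (ord_in oc xi0c) (conj xi0c bxi0).
  exists xi => //; split=> // eta eta_xi; have eta_c := ord_trans oc eta_xi xic.
  have ofe := ord_in od (fd _ eta_c).
  have [bf|fb] := ord_leP (ord_in od bd) ofe; first by case: (xmin eta eta_xi).
  exact: ord_lt_le (ord_in od (fd _ xic)) fb bxi.
have fX xi eta : X xi -> X eta -> (f xi ∈ f eta <-> xi ∈ eta).
  move=> [xic xim] [etac etam]; split=> [fxe|]; last exact: etam.
  have [//|e|ex] := ord_total (ord_in oc xic) (ord_in oc etac).
    by move: fxe; rewrite e => /vin_irr.
  by case: (vin_asym fxe); exact: xim.
have /choice[g gP] : forall y, exists xi, y ∈ x -> X xi /\ f xi = y.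
  move=> y; have [/xP[xi Xxi e]|nyx] := pselect (y ∈ x); last by exists y.
  by exists xi.
have gmono y z : y ∈ x -> z ∈ x -> y ∈ z -> g y ∈ g z.
  by move=> /gP[Xy yE] /gP[Xz zE] yz; apply/fX => //; rewrite yE zE.
have gc y : y ∈ x -> g y ∈ cf d by move=> /gP[[]].
have xcof b : b ∈ d -> exists2 y, y ∈ x & ord_le b y.
  by move=> /recX[xi Xxi bxi]; exists (f xi) => //; apply/xP; exists xi.
have xd : x `<=` d by move=> y /xP[xi [xic _] <-]; exact: fd.
exists x, g; split; first split=> //.
  move=> b bd; have [xi Xxi bxi] := recX b bd; exists xi; first by case: Xxi.
  move=> y yx yb; have [Xy yE] := gP y yx; apply/fX => //; rewrite yE.
  by apply: ord_lt_le yb bxi; apply: ord_in od _; apply: fd; case: Xxi.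
have xc : x #<= cf d.
  apply/card_lePf; exists g => // y z /gP[_ yE] /gP[_ zE] e.
  by rewrite -yE -zE e.
rewrite card_eq_le xc /=; apply: contrapT => ncx.
have [b bc xb] := (card_lt_cardinal x (cf_cardinal od)).1 ((card_ltE _ _).2 (conj xc ncx)).
have [c cd xc'] := cf_bounded (D := x) (f := id) ld bc xb xd.
by have [y yx] := xcof c cd; apply: ord_lt_nle (ord_in od cd) (xc' y yx).
Qed.

Lemma succ_regular (l : V) : is_cardinal l -> infinite_set l -> cf (succ_card l) = succ_card l.
Proof.
move=> cl il; have [cK iK lK Kl] := succ_cardP cl il; have oK := cK.1.
have lim := infinite_cardinal_limit cK iK.
have [oc [f [fK fcof]] cle _] := cfP oK; case: cle => // cK'.
have leK b : b ∈ succ_card l -> b #<= l.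
  by move=> bK; apply/Kl/(card_lt_cardinal _ cK); exists b.
suff : succ_card l #< succ_card l by move/card_ltE => [].
apply/Kl.
apply: (@card_le_trans _ _ _ (\bigcup_(xi in ext (cf (succ_card l))) ext (ord_succ (f xi)))).
  apply: subset_card_le => b /fcof[xi xic bf]; exists xi => //; exact/ord_succP.
apply: (bigcup_le cl.1 il); first exact: leK.
by move=> xi xic; apply: leK; apply: limit_succ => //; exact: fK.
Qed.

(** The size of [d] gives [cf d] at most [l]; equality is excluded because [cf d] is its own
    cofinality and [l] is singular. *)
Lemma singular_cf_lt (l d : V) : singular l -> limit_ordinal d -> d ∈ succ_card l -> cf d ∈ l.
Proof.
move=> [cl il cfl] ld dK; have [cK iK lK Kl] := succ_cardP cl il.
have od := ord_in cK.1 dK; have [oc _ cd _] := cfP od.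
have cl' : cf d #<= l.
  by apply/Kl/(card_lt_cardinal _ cK); exists (cf d) => //; exact: ord_le_lt cK.1 cd dK.
have [//|e] := cardinal_card_le (cf_cardinal od) cl.1 cl'.
by move: cfl; rewrite -e (cf_cf ld) => /vin_irr.
Qed.

(** * From chains to approachability *)

Lemma ord_sup_limit (x d : V) : limit_ordinal d -> x `<=` d ->
  (forall b, b ∈ d -> exists2 y, y ∈ x & ord_le b y) -> ord_sup x = d.
Proof.
move=> ld xd xcof; have od : is_ordinal d by case: ld.
have [|os Ps [sd|//] _] := @leastP [set a | forall c, c ∈ x -> ord_le c a] d od.
  by move=> c /xd cd; left.
rewrite -/(ord_sup x) in os Ps sd *.
have [y yx sy] := xcof _ (limit_succ ld sd).
by case: (ord_lt_nle (ord_in od (xd y yx)) (ord_lt_le (ord_in od (xd y yx)) (ord_succ_lt _) sy) (Ps y yx)).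
Qed.

Lemma ord_sup_cofinal (x d b : V) : is_ordinal d -> x `<=` d -> ord_sup x = d ->
  b ∈ d -> exists2 y, y ∈ x & b ∈ y.
Proof.
move=> od xd xs bd; apply: contrapT => ny; have ob := ord_in od bd.
apply: (ord_lt_nle od bd); rewrite -xs; apply: least_le => // c cx.
by have [//|bc] := ord_leP (ord_in od (xd c cx)) ob; case: ny; exists c.
Qed.

Lemma approachability_ideal_sub (k : V) (A B : set V) :
  A `<=` B -> approachability_ideal k B -> approachability_ideal k A.
Proof.
move=> AB [Bk nB [P [Pk PB]]]; split.
- by move=> a /AB /Bk.
- move=> [_ st]; apply: nB; split; first by move=> a [/Bk].
  by move=> C /st[a [[/AB ? ?] ?]]; exists a.
- by exists P; split=> // a /AB; exact: PB.
Qed.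

(** The ordinals between [l] and its successor form a club that contains no cardinal, whereas an
    ordinal equal to its cofinality is a cardinal. *)
Lemma nonstationary_regulars (l : V) (A : set V) : is_cardinal l -> infinite_set l ->
  ~ stationary (succ_card l) [set d | A d /\ d = cf d].
Proof.
move=> cl il [AK st]; have [cK iK lK Kl] := succ_cardP cl il; have oK := cK.1.
have lim := infinite_cardinal_limit cK iK.
have [|d [[Ad dcf] [dK ld]]] := st [set a | a ∈ succ_card l /\ l ∈ a].
  split=> [a []//|a aK|d dK lim_d cofd].
    have [c ce [ac lc]] := max_ord (ord_in oK aK) cl.1.
    have cK' : c ∈ succ_card l by case: ce => ->.
    by exists (ord_succ c); [split; first exact: limit_succ|]; apply/ord_succP.
  have [b [[bK lb] _ bd]] := cofd _ (limit0 lim_d).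
  by split=> //; exact: ord_trans (ord_in oK dK) lb bd.
have od := ord_in oK dK; have cd : is_cardinal d by rewrite dcf; exact: cf_cardinal.
apply: (ord_lt_nle od ld); apply: cardinal_card_le => //; first exact: cl.1.
by apply/Kl/(card_lt_cardinal _ cK); exists d.
Qed.

Lemma ord_Hset (T a : V) : is_cardinal T -> a ∈ T -> Hset T a.
Proof.
move=> cT; elim/vin_ind: a => a IH aT; constructor.
  by apply/card_lt_cardinal => //; exists a.
by move=> y ya; apply: IH => //; exact: ord_trans cT.1 ya aT.
Qed.

Lemma CECA_tau_approachable (l : V) : singular l ->
  (forall tau, regular tau -> tau ∈ l -> CECA_tau tau (succ_card l)) ->
  approachability_ideal (succ_card l) (ext (succ_card l)).
Proof.
move=> sl ceca; have [cl il cfl] := sl; have [cK iK lK Kl] := succ_cardP cl il.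
have cfK := succ_regular cl il; set K := succ_card l in ceca cK iK lK Kl cfK *.
have oK := cK.1; have lim := infinite_cardinal_limit cK iK.
have leK b : b ∈ K -> b #<= l.
  by move=> bK; apply/Kl/(card_lt_cardinal _ cK); exists b.
have [cT iT KT _] := succ_cardP cK iK.
have /choice[M MP] : forall tau, exists M : V -> V, regular tau /\ tau ∈ l ->
  [/\ forall xi eta, xi ∈ eta -> eta ∈ K -> M xi `<=` M eta,
      forall d, d ∈ K -> limit_ordinal d -> ext (M d) = \bigcup_(xi in ext d) M xi,
      forall xi, xi ∈ K -> weakly_tau_closed tau (M xi) /\ M xi #<= l
    & K `<=` \bigcup_(xi in ext K) M xi].
  move=> tau; have [[rt tl]|nt] := pselect (regular tau /\ tau ∈ l); last by exists id.
  (* The models live in [H] of the successor of [K]; the set to be covered is [K], and [vempty] is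
     taken as the parameter. *)
  have [||||M [[[mono _] cont] closed small _ cover]] := ceca tau rt tl _ cT KT K vempty.
  - by move=> a aK; apply: ord_Hset => //; exact: ord_trans cT.1 aK KT.
  - by move=> a /vin_empty.
  - exact: card_eqxx.
  - by apply/Kl; apply: ord_card_le; [exact: cl.1|left; exact/limit0/infinite_cardinal_limit].
  rewrite cfK in mono cont closed small cover.
  exists M => _; split=> // xi xiK; split; first by case: (closed xi xiK).
  exact/Kl/small.
(* There are at most [l] chains, and [l] is below [cf K], so stages at which [al] is present in each
   of them have a common bound. *)
have /choice[g gP] : forall al, exists b, al ∈ K -> b ∈ K /\
    forall tau, regular tau -> tau ∈ l -> exists2 xi, xi ∈ b & al ∈ M tau xi.
  move=> al; have [alK|nal] := pselect (al ∈ K); last by exists vempty.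
  have /choice[f fP] : forall tau, exists xi, regular tau /\ tau ∈ l -> xi ∈ K /\ al ∈ M tau xi.
    move=> tau; have [tl|nt] := pselect (regular tau /\ tau ∈ l); last by exists vempty.
    by have [_ _ _ /(_ al alK)[xi xiK alM]] := MP tau tl; exists xi.
  have lcf : l ∈ cf K by rewrite cfK.
  have [|tau /fP[]//|b bK fb] := cf_bounded (D := [set tau | regular tau /\ tau ∈ l]) (f := f) lim lcf.
    by apply: subset_card_le => tau [].
  exists b => _; split=> // tau rt tl; exists (f tau); first exact: fb.
  by case: (fP tau (conj rt tl)).
have /choice[x xP] : forall d, exists x : V, limit_ordinal d ->
  x `<=` d /\ exists g : V -> V,
   [/\ forall b, b ∈ d -> exists2 y, y ∈ x & ord_le b y,
      forall y, y ∈ x -> g y ∈ cf d,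
      forall y z, y ∈ x -> z ∈ x -> y ∈ z -> g y ∈ g z
    & forall b, b ∈ d -> exists2 xi, xi ∈ cf d &
        forall y, y ∈ x -> y ∈ b -> g y ∈ xi] /\ x #= cf d.
  move=> d; have [ld|nd] := pselect (limit_ordinal d); last by exists d.
  by have [x [h [[xd ? ? ? ?] ?]]] := cofinal_set ld; exists x => _; split=> //; exists h.
pose P1 (c : V) := [set y : V | y `<=` c /\ exists2 tau, regular tau /\ tau ∈ l & y ∈ M tau c].
pose P2 (c : V) := [set y : V | exists al d b : V,
  [/\ ord_le al c, ord_le d (g al), ord_le b c & y = vset (x d `&` b)]].
have Pl c : c ∈ K -> P1 c `|` P2 c #<= l.
  move=> cinK; apply: (setU_le cl.1 il).
    apply: (@card_le_trans _ _ _ (\bigcup_(tau in [set tau | regular tau /\ tau ∈ l]) ext (M tau c))).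
      by apply: subset_card_le => y [_ [tau rt yM]]; exists tau.
    apply: (bigcup_le cl.1 il); first by apply: subset_card_le => tau [].
    by move=> tau /MP[_ _ /(_ c cinK)[]].
  have sc := limit_succ lim cinK.
  (* A member of [P2 c] is determined by a [d] at most [g al], for some [al] at most [c], and by a
     [b] at most [c]: at most [l] choices for each. *)
  apply: (@card_le_trans _ _ _ ((fun p : V * V => vset (x p.1 `&` p.2)) @`
      ((\bigcup_(al in ext (ord_succ c)) ext (ord_succ (g al))) `*` ext (ord_succ c)))).
    apply: subset_card_le => y [al [d [b [alc dg bc ->]]]]; exists (d, b) => //=.
    by split=> /=; [exists al|]; apply/ord_succP.
  apply: card_le_trans (card_image_le _ _) _; apply: (setX_le cl.1 il); last exact: leK.
  apply: (bigcup_le cl.1 il); first exact: leK.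
  move=> al /ord_succP alc; apply/leK/limit_succ => //.
  by case: (gP al) => //; exact: ord_le_lt oK alc cinK.
have Pset c : c ∈ K -> is_set (P1 c `|` P2 c) by move=> /Pl; exact: is_set_le.
split=> //; first exact: nonstationary_regulars.
exists (fun c => vset (P1 c `|` P2 c)); split=> [c cinK|d dK ld cfd].
  rewrite (vsetE (Pset c cinK)); split; first exact/Kl/Pl.
  move=> y /(vsetP _ (Pset c cinK))[[]//|[al [d [b [_ _ bc ->]]]]] z.
  move=> /(vsetP _ (is_setI _ _))[_ zb].
  exact: ord_lt_le (ord_in oK cinK) zb bc.
have od := ord_in oK dK; have [xd [h [[xcof hc hmono hbnd] xcard]]] := xP d ld.
have [cd _ _] := cf_regular ld; have ocf := cd.1.
have otpx (J : V) : J `<=` x d -> otp J ∈ d.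
  move=> Jx; have oJ y : y ∈ J -> is_ordinal y by move=> /Jx /xd; exact: ord_in.
  rewrite otp_otype //; apply: ord_le_lt od _ cfd.
  apply: (otype_le (g := h)) => // [y /Jx /hc //|y z /Jx yx /Jx zx]; exact: hmono.
(* In the first case [x d] itself is a witness: its initial segments are listed by [P2] from [al]
   on. *)
have [[al [ald dg]]|nal] := pselect (exists al, al ∈ d /\ ord_le d (g al)).
  exists (x d); split=> //; [exact: otpx|exact: ord_sup_limit|].
  move=> b bd; have [c ce [alc bc]] := max_ord (ord_in od ald) (ord_in od bd).
  have cd' : c ∈ d by case: ce => ->.
  exists c => //; apply/(vsetP _ (Pset c _)); first exact: ord_trans oK cd' dK.
  by right; exists al, d, b.
have tau_ok : regular (cf d) /\ cf d ∈ l.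
  by split; [exact: cf_regular|exact: singular_cf_lt].
have [mono cont closed _] := MP _ tau_ok.
have dM : d `<=` M (cf d) d.
  move=> al ald; have alK := ord_trans oK ald dK.
  have [gK /(_ _ tau_ok.1 tau_ok.2)[xi xig alM]] := gP al alK.
  apply: mono alM => //; have [dg|gd] := ord_leP od (ord_in oK gK).
    by case: nal; exists al.
  exact: ord_trans od xig gd.
have [J [Jx Jcf Jsub]] := (closed d dK).1 (x d) (fun y yx => dM y (xd y yx)) xcard.
have Jb b : b ∈ d -> vset (J `&` b) #< cf d.
  move=> bd; have [xi xic hxi] := hbnd b bd; apply/(card_lt_cardinal _ cd).
  exists xi => //; apply/card_lePf; exists h.
    by move=> y /(vsetP _ (is_setI _ _))[/Jx yx yb]; exact: hxi.
  move=> y z /(vsetP _ (is_setI _ _))[/Jx yx _] /(vsetP _ (is_setI _ _))[/Jx zx _] e.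
  have [yz|//|zy] := ord_total (ord_in od (xd y yx)) (ord_in od (xd z zx)).
    by have := hmono _ _ yx zx yz; rewrite e => /vin_irr.
  by have := hmono _ _ zx yx zy; rewrite e => /vin_irr.
have Jd : J `<=` d by move=> y /Jx; exact: xd.
exists J; split=> //; first exact: otpx.
  (* If [J] were bounded by [b], it would be its own initial segment at [b], of size less than
     [cf d]. *)
  apply: ord_sup_limit => // b bd; apply: contrapT => ny.
  have /card_ltE[_] := Jb b bd; apply.
  have -> : vset (J `&` b) = J.
    apply: vext => y; rewrite (vsetP _ (is_setI _ _)); split=> [[]//|yJ].
    split=> //; have [by_|//] := ord_leP (ord_in od bd) (ord_in od (Jd y yJ)).
    by case: ny; exists y.
  by move: Jcf; rewrite card_eq_le => /andP[].
move=> b bd.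
have : vset (J `&` b) ∈ M (cf d) d.
  by apply: Jsub (Jb b bd) => y /(vsetP _ (is_setI _ _))[].
move=> JM; have : ext (M (cf d) d) (vset (J `&` b)) by [].
(* Continuity at [d] brings the segment down to a model before [d]. *)
rewrite cont // => -[ga gad JMga].
have [c ce [gac bc]] := max_ord (ord_in od gad) (ord_in od bd).
have cd' : c ∈ d by case: ce => ->.
have cinK := ord_trans oK cd' dK.
exists c => //; apply/(vsetP _ (Pset c cinK)); left; split.
  move=> y /(vsetP _ (is_setI _ _))[_ yb]; exact: ord_lt_le (ord_in od cd') yb bc.
exists (cf d) => //; case: gac JMga => [gac|->//]; exact: mono.
Qed.

(** * Elementary submodels *)

Fixpoint formula_tree (p : formula) : GenTree.tree nat :=
  match p with
  | FMem i j => GenTree.Node 0 [:: GenTree.Leaf i; GenTree.Leaf j]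
  | FEq i j => GenTree.Node 1 [:: GenTree.Leaf i; GenTree.Leaf j]
  | FNot p => GenTree.Node 2 [:: formula_tree p]
  | FAnd p q => GenTree.Node 3 [:: formula_tree p; formula_tree q]
  | FEx i p => GenTree.Node 4 [:: GenTree.Leaf i; formula_tree p]
  end.

Lemma formula_countable : countable [set: formula].
Proof.
apply/countable_injP; exists (pickle \o formula_tree) => p q _ _ /=.
move=> /(pcan_inj pickleK).
elim: p q => [i j|i j|p IHp|p IHp p' IHp'|i p IHp] [k m|k m|q|q q'|k q] //=.
- by case=> -> ->.
- by case=> -> ->.
- by case=> /IHp ->.
- by case=> /IHp -> /IHp' ->.
- by case=> -> /IHp ->.
Qed.

Fixpoint var_bound (p : formula) : nat :=
  match p with
  | FMem i j | FEq i j => (maxn i j).+1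
  | FNot p | FEx _ p => var_bound p
  | FAnd p q => maxn (var_bound p) (var_bound q)
  end.

Lemma sat_ext (D : set V) (p : formula) (v w : nat -> V) :
  (forall i, (i < var_bound p)%N -> v i = w i) -> (sat D v p <-> sat D w p).
Proof.
elim: p v w => [i j|i j|p IHp|p IHp q IHq|i p IHp] v w /= vw.
- by rewrite !vw // ltnS ?leq_maxl ?leq_maxr.
- by rewrite !vw // ltnS ?leq_maxl ?leq_maxr.
- by rewrite (IHp v w).
- rewrite (IHp v w) ?(IHq v w) // => k kp; apply: vw; rewrite leq_max kp ?orbT//.
- suff H a : sat D [eta v with i |-> a] p <-> sat D [eta w with i |-> a] p.
    by split=> -[a Da /H ?]; exists a.
  by apply: IHp => k kp /=; case: eqP => // _; exact: vw.
Qed.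

(** * Skolem functions and the Tarski-Vaught criterion *)

Section Skolem.
Variables (D : set V) (d0 : V).

(** Assignments are coded by finite lists, so that a set of size at most [l] has at most [l] Skolem
    values, [l] being infinite. Variables beyond the list and formulas without a witness get
    [d0]. *)
Definition skolem (p : formula) (i : nat) (s : seq V) : V :=
  xget d0 [set a | D a /\ sat D [eta nth d0 s with i |-> a] p].

Definition skolem_closed (M : set V) :=
  forall p i s, (forall x, x \in s -> M x) -> M (skolem p i s).

Lemma skolem_in p i s : D d0 -> D (skolem p i s).
Proof. by move=> Dd0; rewrite /skolem; case: xgetP => [a _ []|]. Qed.

Lemma skolem_elementary (M : set V) : M `<=` D -> skolem_closed M ->
  elementary_submodel M D.
Proof.
move=> MD skM; split=> //; first by exists (skolem (FEq 0 0) 0 [::]); exact: skM.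
elim=> [i j|i j|p IHp|p IHp q IHq|i p IHp] v vM //=.
- by rewrite IHp.
- by rewrite IHp // IHq.
have upM a : M a -> forall k, M ([eta v with i |-> a] k).
  by move=> Ma k /=; case: eqP.
split=> [[a Ma /(IHp _ (upM a Ma))]|[a Da sat_a]]; first by exists a => //; exact: MD.
(* Truth of [p] depends on finitely many values of [v], which are collected as the parameters of a
   Skolem function. *)
pose s := mkseq v (var_bound p).
have vs k : (k < var_bound p)%N -> v k = nth d0 s k by move=> kp; rewrite nth_mkseq.
have vsE b : sat D [eta v with i |-> b] p <-> sat D [eta nth d0 s with i |-> b] p.
  by apply: sat_ext => k kp /=; case: eqP => // _; exact: vs.
have skin : M (skolem p i s) by apply: skM => x /mapP[k _ ->].
exists (skolem p i s) => //; apply/(IHp _ (upM _ skin))/vsE.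
by rewrite /skolem; case: xgetP => [b -> []//|/(_ a)[]]; split=> //; exact/vsE.
Qed.

(** By totality of inclusion, a finite list from the union already lies in one [X i]. *)
Lemma skolem_closed_bigcup (I : Type) (dom : set I) (X : I -> set V) : dom !=set0 ->
  (forall i j, dom i -> dom j -> X i `<=` X j \/ X j `<=` X i) ->
  (forall i, dom i -> exists2 j, dom j &
     forall p k s, (forall x, x \in s -> X i x) -> X j (skolem p k s)) ->
  skolem_closed (\bigcup_(i in dom) X i).
Proof.
move=> [i0 di0] tot sk p k s sX.
suff [i di si] : exists2 i, dom i & forall x, x \in s -> X i x.
  by have [j dj skj] := sk i di; exists j => //; exact: skj.
elim: s sX => [|x s IH] sX; first by exists i0.
have [y ys|i di si] := IH; first by apply: sX; rewrite inE ys orbT.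
have [j dj xj] := sX x (mem_head _ _).
have [ij|ji] := tot i j di dj.
  by exists j => // y; rewrite inE => /orP[/eqP->//|/si /ij].
by exists i => // y; rewrite inE => /orP[/eqP->|/si//]; exact: ji.
Qed.
End Skolem.

(** * Weak closure *)

Lemma vsetIP (A : set V) (x y : V) : y ∈ vset (ext x `&` A) <-> y ∈ x /\ A y.
Proof. exact: (vsetP _ (is_setIl _ _)). Qed.

(* If some [z] of size [< tau] lies in no [X d], each point of [I] lies in one of
   the [< tau] many members of the chain that capture the points of [z]. *)
Lemma chain_cover (tau I : V) {D : pointedType} (dom : set D) (X : D -> set V) :
  regular tau -> I #= tau ->
  (forall d e, dom d -> dom e -> X d `<=` X e \/ X e `<=` X d) ->
  (forall y, y ∈ I -> exists2 d, dom d & X d y) ->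
  (exists2 d, dom d & vset (ext I `&` X d) #= tau) \/
  (forall z : V, z `<=` I -> z #< tau -> exists2 d, dom d & z `<=` X d).
Proof.
move=> rt It tot cov; apply: contrapT => /not_orP[nbig nz]; apply: nz => z zI zt.
apply: contrapT => nd.
have /choice[r rP] : forall y, exists d, y ∈ I -> dom d /\ X d y.
  move=> y; have [yI|nyI] := pselect (y ∈ I); last by exists point.
  by have [d dd Xd] := cov y yI; exists d.
move: It; rewrite card_eq_le => /andP[It tI].
apply: (@regular_bigcup tau z (fun y => vset (ext I `&` X (r y))) rt zt).
  move=> y zy; have [dy Xy] := rP y (zI y zy).
  apply/card_ltE; split=> [|tle].
    by apply: card_le_trans It; apply: subset_card_le => u /vsetIP[].
  apply: nbig; exists (r y) => //; rewrite card_eq_le tle andbT.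
  by apply: card_le_trans It; apply: subset_card_le => u /vsetIP[].
apply: card_le_trans tI _; apply: subset_card_le => y' y'I.
have [dy' Xy'] := rP y' y'I.
(* A point [y] of [z] outside [X (r y')] makes [X (r y)] the larger of the two, so it captures [y']
   too. *)
have [y [zy nXy]] : exists y, y ∈ z /\ ~ X (r y') y.
  apply: contrapT => ny; apply: nd; exists (r y') => // y zy.
  by apply: contrapT => nXy; apply: ny; exists y.
have [dy Xy] := rP y (zI y zy).
exists y => //; apply/vsetIP; split=> //.
by have [sub|sub] := tot _ _ dy dy'; [case: nXy; exact: sub|exact: sub].
Qed.

Lemma wf_minimal {D : Type} (R : D -> D -> Prop) (P : set D) d : well_founded R ->
  P d -> exists2 e, P e & forall e', R e' e -> ~ P e'.
Proof.
move=> wfR; elim/(well_founded_ind wfR): d => d IH Pd.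
have [[e [ed Pe]]|ne] := pselect (exists e, R e d /\ P e); first exact: IH ed Pe.
by exists d => // e ed Pe; apply: ne; exists e.
Qed.

(* [h (Q d) y ∈ al] cuts [Q d] into an increasing sequence of length [l] of
   small pieces. *)
Lemma weakly_closed_chain (l : V) (h : V -> V -> V) {D : pointedType}
    (R : D -> D -> Prop) (dom c : set D) (Q : D -> V) (U : V) :
  limit_ordinal l -> well_founded R ->
  (forall d e, dom d -> dom e -> [\/ R d e, d = e | R e d]) ->
  (forall d e, dom d -> dom e -> R d e -> Q d `<=` Q e) ->
  (forall y, y ∈ U -> exists2 d, dom d & y ∈ Q d) ->
  (forall d y, dom d -> y ∈ Q d -> h (Q d) y ∈ l) ->
  c `<=` dom -> (forall d, dom d -> exists2 e, c e & d = e \/ R d e) ->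
  (forall d al z, dom d -> al ∈ l ->
     (forall y, y ∈ z -> y ∈ Q d /\ h (Q d) y ∈ al) -> z ∈ U) ->
  (forall e al z, c e -> al ∈ l ->
     (forall y, y ∈ z -> exists e', [/\ c e', e' = e \/ R e' e, y ∈ Q e' & h (Q e') y ∈ al]) ->
     z ∈ U) ->
  weakly_closed U.
Proof.
move=> ll wfR tot mono cov hl cdom ccof sub1 sub2 tau rt I IU It.
have ol : is_ordinal l by case: ll.
have totQ d e : dom d -> dom e -> Q d `<=` Q e \/ Q e `<=` Q d.
  move=> dd de; have [de_|->|ed] := tot d e dd de; [left; exact: mono|by left|right; exact: mono].
(* The sublevel sets of [k] increase along [l]: either one of them contains [tau] points of [J], or
   each subset of [J] of size less than [tau] has its values below some [al]. *)
have levels (J : V) (k : V -> V) : J #= tau -> (forall y, y ∈ J -> k y ∈ l) ->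
    exists J' : V, [/\ J' `<=` J, J' #= tau & forall z : V, z `<=` J' -> z #< tau ->
      exists2 al, al ∈ l & forall y, y ∈ z -> k y ∈ al].
  move=> Jt kl.
  have [||[al all Jal]|bnd] := @chain_cover tau J V (ext l) (fun al => [set y | k y ∈ al]) rt Jt.
  - move=> al be all bel; have [/(ord_le_sub (ord_in ol bel)) ab|ba] := ord_leP (ord_in ol all) (ord_in ol bel).
      by left=> y; exact: ab.
    by right=> y /= kb; exact: ord_trans (ord_in ol all) kb ba.
  - by move=> y yJ; exists (ord_succ (k y)); [exact/limit_succ/kl|exact: ord_succ_lt].
  - exists (vset (ext J `&` [set y | k y ∈ al])); split=> //; first by move=> y /vsetIP[].
    by move=> z zJ _; exists al => // y /zJ /vsetIP[].
  - by exists J; split.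
have Ucov y : y ∈ I -> exists2 d, dom d & y ∈ Q d by move=> /IU; exact: cov.
(* Either one [Q d] contains [tau] points of [I], and [sub1] applies, or each subset of [I] of size
   less than [tau] lies in some [Q d], and [sub2] will apply. *)
have [[d dd Id]|inQ] := chain_cover rt It totQ Ucov.
  have [|J [JI Jt Jbnd]] := levels _ (h (Q d)) Id; first by move=> y /vsetIP[_]; exact: hl.
  exists J; split=> // [y /JI /vsetIP[]//|z zJ zt].
  have [al all zal] := Jbnd z zJ zt; apply: (sub1 d al) => // y yz; split; last exact: zal.
  by have /vsetIP[] := JI _ (zJ _ yz).
(* [r y] is the first index in [c] at which [y] appears, so it comes no later than any index in [c]
   whose [Q] contains [y]. The level of [y] is measured in [Q (r y)]. *)
have /choice[r rP] : forall y, exists e, y ∈ I -> [/\ c e, y ∈ Q e &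
    forall e', c e' -> y ∈ Q e' -> e = e' \/ R e e'].
  move=> y; have [yI|nyI] := pselect (y ∈ I); last by exists point.
  have [d dd yd] := Ucov y yI; have [e ce de] := ccof d dd.
  have ye : y ∈ Q e by case: de => [<-//|de]; exact: mono dd (cdom _ ce) de y yd.
  have [e1 [ce1 ye1] emin] := wf_minimal (P := [set e | c e /\ y ∈ Q e]) wfR (conj ce ye).
  exists e1 => _; split=> // e' ce' ye'.
  have [?|?|e'e] := tot e1 e' (cdom _ ce1) (cdom _ ce'); [by right|by left|].
  by case: (emin e' e'e).
have [|J [JI Jt Jbnd]] := levels I (fun y => h (Q (r y)) y) It.
  by move=> y /rP[/cdom ? ? _]; exact: hl.
exists J; split=> // z zJ zt; have zI : z `<=` I by move=> y /zJ; exact: JI.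
have [al all zal] := Jbnd z zJ zt; have [d dd zd] := inQ z zI zt.
have [e ce de] := ccof d dd.
apply: (sub2 e al) => // y yz; have [cr yr rmin] := rP y (zI y yz).
exists (r y); split=> //; last exact: zal.
apply: rmin => //; case: de => [<-|de]; first exact: zd.
exact: mono dd (cdom _ ce) de y (zd y yz).
Qed.

(** * Sets of size less than [l], and closing a set off to a weakly closed elementary submodel *)

Definition small (l : V) {T} (A : set T) := exists2 b, b ∈ l & A #<= b.

Lemma small_sub (l : V) {T U} (A : set T) (B : set U) : A #<= B -> small l B -> small l A.
Proof. by move=> AB [b bl Bb]; exists b => //; exact: card_le_trans Bb. Qed.

Lemma small_infinite (l : V) {T} (A : set T) : singular l -> small l A ->
  exists b, [/\ b ∈ l, infinite_set b & A #<= b].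
Proof.
move=> [cl il cfl] [b bl Ab]; have ol := cl.1.
have ic := cf_infinite (infinite_cardinal_limit cl il).
(* The bound becomes infinite by joining it with [cf l], which is infinite and below [l]. *)
have [c ce [bc cc]] := max_ord (ord_in ol bl) (ord_in ol cfl).
have cl' : c ∈ l by case: ce => ->.
exists c; split=> //.
  by apply: infinite_card_le ic; apply: ord_card_le cc; exact: ord_in cl'.
by apply: card_le_trans Ab _; apply: ord_card_le bc; exact: ord_in cl'.
Qed.

Lemma small_bigcup (l : V) {I T} (J : set I) (F : I -> set T) (b : V) : singular l ->
  small l J -> b ∈ l -> (forall i, J i -> F i #<= b) -> small l (\bigcup_(i in J) F i).
Proof.
move=> sl sJ bl Fb; have [c [cl ic Jc]] := small_infinite sl sJ.
have [[ol _] _ _] := sl.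
have [d de [cd bd]] := max_ord (ord_in ol cl) (ord_in ol bl).
have dl : d ∈ l by case: de => ->.
have od := ord_in ol dl; have cdc := ord_card_le od cd.
exists d => //; apply: bigcup_le => //; first exact: infinite_card_le ic.
  exact: card_le_trans cdc.
by move=> i /Fb Fib; apply: card_le_trans Fib _; exact: ord_card_le.
Qed.

Lemma small_power_le (l : V) (A : set V) : singular l -> strong_limit l -> small l A ->
  [set z : V | z `<=` A] #<= l.
Proof.
move=> [cl il cfl] slim [b bl Ab]; have ol := cl.1.
have [m cm [mb]] := ord_cardinal (ord_in ol bl); rewrite card_eq_le => /andP[_ bm].
have ml : m ∈ l by exact: ord_le_lt ol mb bl.
have [f fm finj] := (card_lePf A m).1 (card_le_trans Ab bm).
have /card_ltE[Pl _] := slim m cm ml; apply: card_le_trans Pl.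
apply/card_lePf; exists (fun z => vset (f @` z)).
  by move=> z zA u /(vsetP _ (is_set_image _ _))[y /zA /fm ? <-].
have sub (z w : V) : z `<=` A -> w `<=` A -> vset (f @` z) = vset (f @` w) -> z `<=` w.
  move=> zA wA e y yz; have : f y ∈ vset (f @` z).
    by apply/(vsetP _ (is_set_image _ _)); exists y.
  rewrite e => /(vsetP _ (is_set_image _ _))[y' y'w] /finj <- //; first exact: wA.
  exact: zA.
move=> z w zA wA e; apply: vext => y; split; first exact: sub.
by apply: sub => //; exact: esym.
Qed.

Section WeakClosure.
Variables (l : V) (D : set V) (h : V -> V -> V).
Hypotheses (sl : singular l) (slim : strong_limit l).
Hypothesis hP : forall X : V, X #<= l -> (forall y, y ∈ X -> h X y ∈ l) /\
  forall y z, y ∈ X -> z ∈ X -> h X y = h X z -> y = z.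
Hypothesis DP : forall x : V, x `<=` D -> x #<= l -> D x.

Let ol : is_ordinal l. Proof. by case: sl => -[]. Qed.
Let il : infinite_set l. Proof. by case: sl. Qed.
Let ll : limit_ordinal l. Proof. by case: sl => ? ? _; exact: infinite_cardinal_limit. Qed.

Definition slice (X al : V) : set V := [set y | y ∈ X /\ h X y ∈ al].

Lemma slice_le (X al : V) : X #<= l -> al ∈ l -> slice X al #<= al.
Proof.
move=> /hP[hl hinj] all; apply/card_lePf; exists (h X) => [y []//|y z [yX _] [zX _]].
exact: hinj.
Qed.

Lemma D_empty : D vempty.
Proof.
apply: DP => [x /vin_empty//|].
by apply: (ord_card_le ol); left; exact: limit0.
Qed.

(** The Skolem values lead to elementarity. The last summand provides the sets that
    [weakly_closed_chain] asks for along a chain of length omega, whose initial segments are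
    finite. *)
Definition weak_step (n : nat) (Q : nat -> V) : set V :=
  Q n `|` [set y | exists p i s, (forall x, x \in s -> x ∈ Q n) /\ y = skolem D vempty p i s]
  `|` [set z : V | exists2 al, al ∈ l & z `<=` \bigcup_(k in `I_n.+1) slice (Q k) al].

Lemma ltn_well_founded : well_founded (fun m n : nat => (m < n)%N).
Proof. by elim/ltn_ind=> n IH; constructor=> m; exact: IH. Qed.

Definition weak_chain (X : V) : nat -> V :=
  wfrec ltn_well_founded (fun n Q => if n is m.+1 then vset (weak_step m Q) else X).

Lemma weak_chain_eq (X : V) n : weak_chain X n =
  if n is m.+1 then vset (weak_step m (weak_chain X)) else X.
Proof.
rewrite {1}/weak_chain wfrecP // => -[//|m] f g fg.
rewrite /weak_step (fg m) //; congr (vset (_ `|` _)).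
apply/seteqP; split=> z [al all zs]; exists al => //; move: zs.
  by rewrite (eq_bigcupr (G := fun k => slice (g k) al)) // => k km; rewrite fg.
by rewrite (eq_bigcupr (G := fun k => slice (f k) al)) // => k km; rewrite fg.
Qed.

Definition weak_closure (X : V) : V := vset (\bigcup_(n in [set: nat]) ext (weak_chain X n)).

Variable X : V.
Hypotheses (XD : X `<=` D) (Xl : X #<= l).

Let Q := weak_chain X.

Let weak_step_le n : (forall k, (k <= n)%N -> Q k #<= l) -> weak_step n Q #<= l.
Proof.
move=> Ql; apply: setU_le => //; first apply: setU_le => //; first exact: Ql.
  apply: (@card_le_trans _ _ _ ((fun p => skolem D vempty p.1.1 p.1.2 p.2) @`
    (([set: formula] `*` [set: nat]) `*` [set s : seq V | forall x, x \in s -> x ∈ Q n]))).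
    by apply: subset_card_le => y [p [i [s [sQ ->]]]]; exists (p, i, s).
  apply: card_le_trans (card_image_le _ _) _; apply: setX_le => //.
    apply: setX_le => //; first exact: (countable_le il formula_countable).
    exact: (countable_le il (countableP _)).
  by apply: seq_le => //; exact: Ql.
have -> : [set z : V | exists2 al, al ∈ l & z `<=` \bigcup_(k in `I_n.+1) slice (Q k) al] =
    \bigcup_(al in ext l) [set z : V | z `<=` \bigcup_(k in `I_n.+1) slice (Q k) al].
  by apply/seteqP; split=> z [al]; exists al.
apply: bigcup_le => // al all; apply: small_power_le => //.
apply: (small_bigcup sl (b := al)) => //; last by move=> k kn; apply: slice_le => //; exact: Ql.
(* [cf l], infinite and below [l], bounds the finite number of slices. *)
have [_ _ cfl] := sl; exists (cf l) => //.
have /infiniteP := cf_infinite ll; apply: card_le_trans.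
exact/countableP.
Qed.

Let Q_le n : Q n #<= l.
Proof.
have [k] := ubnP n; elim: k n => // k IH [|n] nk; rewrite /Q weak_chain_eq //.
have le := @weak_step_le n (fun i iN => IH i (leq_ltn_trans iN nk)).
by rewrite (vsetE (is_set_le le)).
Qed.

Let Q_succ n z : z ∈ Q n.+1 <-> weak_step n Q z.
Proof.
have -> : Q n.+1 = vset (weak_step n Q) by rewrite /Q weak_chain_eq.
by apply: vsetP; apply: (@is_set_le _ l); exact: weak_step_le.
Qed.

Let Q_mono m n : (m <= n)%N -> Q m `<=` Q n.
Proof.
move=> /subnK <-; elim: (n - m)%N => [//|k IH] y /IH yQ.
by rewrite addSn; apply/Q_succ; left; left.
Qed.

Let Q_total m n : Q m `<=` Q n \/ Q n `<=` Q m.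
Proof. by have [mn|/ltnW nm] := leqP m n; [left|right]; exact: Q_mono. Qed.

Let Q_D n : Q n `<=` D.
Proof.
have [k] := ubnP n; elim: k n => // k IH [|n] nk z; first by rewrite /Q weak_chain_eq => /XD.
move=> /Q_succ[[|[p [i [s [_ ->]]]]]|[al all zs]]; first exact: IH.
  by apply: skolem_in; exact: D_empty.
apply: DP => [y /zs[i iN [yQ _]]|]; first by apply: IH yQ; exact: leq_ltn_trans iN nk.
apply: card_le_trans (Q_le n); apply: subset_card_le => y /zs[i iN [yQ _]].
exact: Q_mono yQ.
Qed.

Let W_le : \bigcup_(n in [set: nat]) ext (Q n) #<= l.
Proof. by apply: bigcup_le => //; apply: countable_le => //; exact: countableP. Qed.

Lemma weak_closureP y : y ∈ weak_closure X <-> exists n, y ∈ Q n.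
Proof.
by rewrite (vsetP _ (is_set_le W_le)); split=> [[n _]|[n]]; exists n.
Qed.

Lemma weak_closure_le : weak_closure X #<= l.
Proof. by rewrite (vsetE (is_set_le W_le)). Qed.

Lemma sub_weak_closure : X `<=` weak_closure X.
Proof. by move=> y yX; apply/weak_closureP; exists 0; rewrite /Q weak_chain_eq. Qed.

Lemma weak_closure_sub : weak_closure X `<=` D.
Proof. by move=> y /weak_closureP[n]; exact: Q_D. Qed.

Lemma weak_closure_skolem : skolem_closed D vempty (weak_closure X).
Proof.
rewrite (vsetE (is_set_le W_le)); apply: skolem_closed_bigcup => [|m n _ _|n _].
- by exists 0.
- exact: Q_total.
- by exists n.+1 => // p i s sQ; apply/Q_succ; left; right; exists p, i, s.
Qed.

Lemma weak_closure_closed : weakly_closed (weak_closure X).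
Proof.
have QU n : Q n `<=` weak_closure X by move=> y yQ; apply/weak_closureP; exists n.
apply: (weakly_closed_chain (h := h) (dom := [set: nat]) (c := [set: nat]) (Q := Q)
  ll ltn_well_founded) => //.
- by move=> m n _ _; case: (ltngtP m n) => ?; [constructor 1|constructor 3|constructor 2].
- by move=> m n _ _ /ltnW; exact: Q_mono.
- by move=> y /weak_closureP[n]; exists n.
- by move=> n y _; exact: (hP (Q_le n)).1.
- by move=> n _; exists n => //; left.
- move=> n al z _ all zs; apply: (QU n.+1); apply/Q_succ; right; exists al => // y yz.
  by exists n => /=; [exact: ltnSn|exact: zs].
- move=> n al z _ all zs; apply: (QU n.+1); apply/Q_succ; right; exists al => // y /zs.
  move=> [m [_ mn yQ yal]]; exists m => //=.
  by case: mn => [->|/leqW].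
Qed.
End WeakClosure.

(** * From approachability to chains *)

(** The position of a point up to [b] depends only on the part of [x] below [b]; hence trimming by
    positions commutes with taking initial segments. *)
Lemma collapse_restrict (x b y : V) : is_ordinal b -> ord_le y b ->
  collapse (vset (x `&` b)) y = collapse x y.
Proof.
move=> ob; elim/vin_ind: y => y IH yb; apply: vext => u.
have by_ z : z ∈ y -> z ∈ b by move=> zy; exact: ord_lt_le zy yb.
rewrite !collapseP; split=> [[z [/vsetIP[zx _] zy ->]]|[z [zx zy ->]]].
  by exists z; split=> //; apply: IH => //; left; exact: by_.
exists z; split=> //; first by apply/vsetIP; split=> //; exact: by_.
by rewrite IH //; left; exact: by_.
Qed.

(** No order type is mentioned: smallness will be required of the members of [W] instead. *)
Definition approaches (W : V -> set V) (d x : V) :=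
  [/\ x `<=` d, forall b, b ∈ d -> exists2 y, y ∈ x & ord_le b y
    & forall b, b ∈ d -> exists2 c, c ∈ d & W c (vset (x `&` b))].

(* An approaching set [x] is thinned out to the points whose position in [x]
   lies in a cofinal set [E rho] chosen once for all for each [rho]; since
   [rho = otp x < d], the initial segments of the result remain enumerated
   before [d]. *)
Lemma approach_family (l : V) : singular l ->
  (forall tau, regular tau -> tau ∈ l ->
     approachability_ideal (succ_card l) (cof_stratum (succ_card l) tau)) ->
  exists W : V -> set V,
    [/\ forall c, c ∈ succ_card l -> W c #<= l,
        forall c w, c ∈ succ_card l -> W c w -> w `<=` ord_succ c /\ small l w,
        forall c, W c (vset [set c])
      & forall d, d ∈ succ_card l -> limit_ordinal d -> exists x, approaches W d x].
Proof.
move=> sl appr; have [cl il cfl] := sl; have [cK iK lK Kl] := succ_cardP cl il.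
have oK := cK.1; set K := succ_card l in appr cK iK lK Kl oK *.
have lim := infinite_cardinal_limit cK iK; have ol := cl.1.
have ll := infinite_cardinal_limit cl il.
have leK b : b ∈ K -> b #<= l.
  by move=> bK; apply/Kl/(card_lt_cardinal _ cK); exists b.
have /choice[P PP] : forall tau, exists P : V -> V, regular tau /\ tau ∈ l ->
  (forall a, a ∈ K -> P a #<= l /\ forall y, y ∈ P a -> y `<=` a) /\
  (forall a, a ∈ K -> cf a = tau -> limit_ordinal a -> cf a ∈ a -> exists x : V,
    [/\ x `<=` a, otp x ∈ a, ord_sup x = a
      & forall b, b ∈ a -> exists2 c, c ∈ a & vset (x `&` b) ∈ P c]).
  move=> tau; have [[rt tl]|nt] := pselect (regular tau /\ tau ∈ l); last by exists id.
  have [_ _ [P [P1 P2]]] := appr tau rt tl; exists P => _; split=> [a /P1[/Kl]//|a aK cfa].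
  by apply: P2; split.
have /choice[E EP] : forall rho, exists E : V, limit_ordinal rho ->
    [/\ E `<=` rho, forall b, b ∈ rho -> exists2 y, y ∈ E & ord_le b y & E #= cf rho].
  move=> rho; have [lr|nr] := pselect (limit_ordinal rho); last by exists rho.
  by have [x [g [[? ? _ _ _] ?]]] := cofinal_set lr; exists x.
pose trim w rho : V := vset (ext w `&` [set y | collapse w y ∈ E rho]).
(* [W0] holds the trimmed sets and [W1] the ordinals below [l], meant for those [d] with [cf d = d];
   the singletons answer the third clause. *)
pose W0 c := [set w | small l (ext w) /\ exists tau a rho u,
  [/\ regular tau /\ tau ∈ l, ord_le a c, ord_le rho c, a ∈ K /\ u ∈ P tau a & w = trim u rho]].
pose W1 c := [set w | ord_le w c /\ w ∈ l].
pose W c := W0 c `|` W1 c `|` [set vset [set c]].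
have single_le c : small l (ext (vset [set c])).
  exists (cf l) => //; rewrite (vsetE (is_set1 c)).
  by apply: set1_le; exact: cf_infinite.
exists W; split=> [c cinK|c w cinK [[]|->]|c|d dK ld].
- have sc := limit_succ lim cinK; apply: setU_le => //; last exact: set1_le.
  apply: setU_le => //; last by apply: subset_card_le => w [].
  apply: (@card_le_trans _ _ _ ((fun p : V * V => trim p.1 p.2) @`
    ((\bigcup_(tau in [set tau | regular tau /\ tau ∈ l]) \bigcup_(a in ext (ord_succ c)) ext (P tau a))
      `*` ext (ord_succ c)))).
    apply: subset_card_le => w [_ [tau [a [rho [u [rt ac rc [aK uP] ->]]]]]].
    exists (u, rho) => //; split; last exact/ord_succP.
    by exists tau => //; exists a => //; exact/ord_succP.
  apply: card_le_trans (card_image_le _ _) _; apply: setX_le => //; last exact: leK.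
  apply: bigcup_le => // [|tau rt]; first by apply: subset_card_le => tau [].
  apply: bigcup_le => // [|a /ord_succP ac]; first exact: leK.
  by have [/(_ a (ord_le_lt oK ac cinK))[]] := PP tau rt.
- move=> [sw [tau [a [rho [u [rt ac _ [aK uP] wE]]]]]]; split=> //.
  rewrite wE => y /vsetIP[yu _]; apply/ord_succP; left.
  have [/(_ a aK)[_ Pa] _] := PP tau rt.
  case: ac => [ac|<-]; last exact: Pa uP y yu.
  exact: ord_trans (ord_in oK cinK) (Pa u uP y yu) ac.
- move=> [wc wl]; split=> [y yw|]; last by exists w => //; exact: card_lexx.
  by apply/ord_succP; left; exact: ord_lt_le (ord_in oK cinK) yw wc.
- split; last exact: single_le.
  by move=> y /(vsetP _ (is_set1 c)) ->; exact: ord_succ_lt.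
- by right.
have od := ord_in oK dK; have cdl := singular_cf_lt sl ld dK.
(* If [cf d = d], then [d] is below [l] and approaches itself, its initial segments being ordinals
   below [l]. *)
have [_ _ [cfd|cfd] _] := cfP od; last first.
  have dl : d ∈ l by rewrite -cfd.
  exists d; split=> // [b bd|b bd]; first by exists b => //; right.
  exists b => //; left; right.
  have -> : vset (d `&` b) = b.
    apply: vext => y; rewrite vsetIP; split=> [[]//|yb]; split=> //; exact: ord_trans yb bd.
  by split; [right|exact: ord_trans bd dl].
have rt : regular (cf d) /\ cf d ∈ l by split; first exact: cf_regular.
have [P1 /(_ d dK erefl ld cfd)[x [xd otpx supx xP]]] := PP _ rt.
have ox y : y ∈ x -> is_ordinal y by move=> /xd; exact: ord_in.
rewrite (otp_otype ox) in otpx; set rho := otype x in otpx.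
have orho : is_ordinal rho by exact: otype_ord.
have xcof b : b ∈ d -> exists2 y, y ∈ x & b ∈ y by exact: ord_sup_cofinal.
have inrho y : y ∈ x -> collapse x y ∈ rho by move=> yx; apply/otypeP; exists y.
have lrho : limit_ordinal rho.
  split=> // [r0|b /otypeP[y yx ->]].
    have [y yx _] := xcof _ (limit0 ld).
    by have := inrho y yx; rewrite r0 => /vin_empty.
  have [z zx yz] := xcof y (xd y yx).
  by exists (collapse x z); [exact: inrho|exact: collapse_lt].
have [Erho Ecof Ecf] := EP rho lrho.
have trimx : trim x rho `<=` x by move=> y /vsetIP[].
exists (trim x rho); split=> [y /trimx /xd//|b bd|b bd].
  (* The point [z] of [x] at a position [u] in [E rho], at or past the position of [y], is itself at
     or past [y]. *)
  have [y yx b_y] := xcof b bd; have [u uE yu] := Ecof _ (inrho y yx).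
  have /otypeP[z zx uz] := Erho u uE.
  exists z; first by apply/vsetIP; split=> //=; rewrite -uz.
  left; apply: (ord_lt_le (ox z zx) b_y).
  have [//|zy] := ord_leP (ox y yx) (ox z zx).
  case: (ord_lt_nle _ (collapse_lt zx zy)); last by rewrite -uz.
  exact: ord_in orho (inrho y yx).
have [a ad aP] := xP b bd; have [c ce [ac rc]] := max_ord (ord_in od ad) (ord_in od otpx).
have cd' : c ∈ d by case: ce => ->.
exists c => //; left; left; split.
  (* The positions embed the segment in [E rho], of size [cf rho], which is below [l] as [rho] is a
     limit below [K]. *)
  exists (cf rho); first by apply: singular_cf_lt lrho _ => //; exact: ord_trans otpx dK.
  move: Ecf; rewrite card_eq_le => /andP[+ _]; apply: card_le_trans.
  apply/card_lePf; exists (collapse x) => [y /vsetIP[/vsetIP[]]//|y z].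
  move=> /vsetIP[/vsetIP[yx _] _] /vsetIP[/vsetIP[zx _] _].
  by have [_ inj _] := collapse_bij ox; apply: inj; rewrite inE.
exists (cf d), a, rho, (vset (x `&` b)); split=> //.
  by split=> //; exact: ord_trans ad dK.
have ob := ord_in od bd.
apply: vext => y; rewrite !vsetIP /=; split.
  by move=> [[yx yE] yb]; split=> //; rewrite collapse_restrict //; left.
by move=> [[yx yb]]; rewrite collapse_restrict //; left.
Qed.

Lemma not_limit_succ b : is_ordinal b -> ~ limit_ordinal (ord_succ b).
Proof.
move=> ob [osb _ /(_ b (ord_succ_lt b))[c csb bc]].
by have /ord_succP := csb; exact: ord_lt_nle (ord_in osb csb) bc.
Qed.

(** * The chain of models *)

Section Chain.
Variables (l : V) (D : set V) (h : V -> V -> V) (W : V -> set V) (B : V) (e : V -> V).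
Hypotheses (sl : singular l) (slim : strong_limit l).
Hypothesis hP : forall X : V, X #<= l -> (forall y, y ∈ X -> h X y ∈ l) /\
  forall y z, y ∈ X -> z ∈ X -> h X y = h X z -> y = z.
Hypothesis DP : forall x : V, x `<=` D -> x #<= l -> D x.

Let K := succ_card l.
Hypothesis KD : K `<=` D.
Hypothesis BD : D B.
Hypothesis eD : forall b, b ∈ K -> D (e b).
Hypothesis W_le : forall c, c ∈ K -> W c #<= l.
Hypothesis WP : forall c w, c ∈ K -> W c w -> w `<=` ord_succ c /\ small l w.
Hypothesis W1 : forall c, W c (vset [set c]).
Hypothesis W_approaches :
  forall d, d ∈ K -> limit_ordinal d -> exists x, approaches W d x.

(** For [w] included in [b + 1] the intersection with [a] removes nothing; it makes the recursion
    refer to earlier models only. *)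
Definition chain_pieces (M : V -> V) (a : V) : set V :=
  \bigcup_(b in ext a) \bigcup_(w in W b) \bigcup_(al in ext l)
    [set z : V | z `<=` \bigcup_(eta in ext w `&` a) slice h (M eta) al].

(** [vseq M a] makes the sequence an ∈-chain; [e] will enumerate the set to be covered. *)
Definition chain_input (M : V -> V) (a : V) : set V :=
  \bigcup_(b in ext a) ext (M b) `|` ([set vseq M a] `|` [set B]) `|`
  (e @` a `|` chain_pieces M a).

(** Unions at limits give continuity. Zero falls under the other case, which puts [B] into the first
    model. *)
Definition chain_step (a : V) (M : V -> V) : V :=
  if pselect (limit_ordinal a) then vset (\bigcup_(b in ext a) ext (M b))
  else weak_closure l D h (vset (chain_input M a)).

Definition chain : V -> V := wfrec vin_wf chain_step.

Lemma chain_eq a : chain a = chain_step a chain.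
Proof.
rewrite {1}/chain wfrecP // => {}a f g fg.
have fgU : \bigcup_(b in ext a) ext (f b) = \bigcup_(b in ext a) ext (g b).
  by apply: eq_bigcupr => b ba; rewrite fg.
rewrite /chain_step fgU; case: (pselect (limit_ordinal a)) => //= ?; congr (weak_closure _ _ _ (vset _)).
rewrite /chain_input fgU; congr (_ `|` ([set _] `|` _) `|` (_ `|` _)).
  by congr vset; apply: eq_imagel => b ba; rewrite fg.
apply: eq_bigcupr => b ba; apply: eq_bigcupr => w _; apply: eq_bigcupr => al _.
rewrite (eq_bigcupr (G := fun eta => slice h (g eta) al)) // => eta [_ etaa].
by rewrite fg.
Qed.

Let cl : is_cardinal l. Proof. by case: sl. Qed.
Let il : infinite_set l. Proof. by case: sl. Qed.
Let ol : is_ordinal l. Proof. by case: cl. Qed.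
Let ll : limit_ordinal l. Proof. exact: infinite_cardinal_limit. Qed.
Let cK : is_cardinal K. Proof. by have [] := succ_cardP cl il. Qed.
Let oK : is_ordinal K. Proof. by case: cK. Qed.
Let lK : limit_ordinal K.
Proof. by have [_ iK _ _] := succ_cardP cl il; exact: infinite_cardinal_limit. Qed.
Let leK b : b ∈ K -> b #<= l.
Proof.
have [_ _ _ Kl] := succ_cardP cl il.
by move=> bK; apply/Kl/(card_lt_cardinal _ cK); exists b.
Qed.

Let D_set2 x y : D x -> D y -> D (vset [set x; y]).
Proof.
move=> Dx Dy; have le : [set x; y] #<= l by apply: setU_le => //; exact: set1_le.
by apply: DP; rewrite (vsetE (is_set_le le)) // => z [] ->.
Qed.

Let D_opair x y : D x -> D y -> D (opair x y).
Proof.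
move=> Dx Dy; have -> : opair x y = vset [set vset [set x; x]; vset [set x; y]].
  by rewrite /opair setUid.
by apply: D_set2; exact: D_set2.
Qed.

(** One induction for everything, since the bounds on the earlier models are what makes the next
    input a set of size at most [l] inside [D]. *)
Lemma chain_facts a : a ∈ K ->
  [/\ chain a `<=` D, chain a #<= l &
    ~ limit_ordinal a ->
    [/\ is_set (chain_input chain a), chain_input chain a #<= l
      & chain_input chain a `<=` D]].
Proof.
elim/vin_ind: a => a IH aK.
have aD b : b ∈ a -> chain b `<=` D by move=> ba; have [] := IH b ba (ord_trans oK ba aK).
have al b : b ∈ a -> chain b #<= l by move=> ba; have [] := IH b ba (ord_trans oK ba aK).
have Ule : \bigcup_(b in ext a) ext (chain b) #<= l.
  by apply: bigcup_le => //; exact: leK.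
have UD : \bigcup_(b in ext a) ext (chain b) `<=` D by move=> y [b /aD]; apply.
have input_le : chain_input chain a #<= l.
  apply: setU_le => //; apply: setU_le => //.
  - by apply: setU_le => //; exact: set1_le.
  - by apply: card_le_trans (card_image_le _ _) _; exact: leK.
  apply: bigcup_le => // [|b ba]; first exact: leK.
  have bK := ord_trans oK ba aK.
  apply: bigcup_le => // [|w wb]; first exact: W_le.
  apply: bigcup_le => // be bel; apply: small_power_le => //.
  have [_ sw] := WP bK wb.
  (* Fewer than [l] slices, each of size at most that of [be]: the union is small, and the strong
     limit hypothesis leaves at most [l] subsets. *)
  apply: (small_bigcup sl (b := be)) => // [|eta [_ etaa]].
    by apply: small_sub sw; apply: subset_card_le => eta [].
  by apply: (slice_le hP) => //; exact: al.
have input_D : chain_input chain a `<=` D.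
  move=> y [[/UD//|[->|->//]]|[[b ba <-]|]].
  - apply: DP; first last.
      rewrite (vsetE (is_set_image _ _)); apply: card_le_trans (card_image_le _ _) _.
      exact: leK.
    move=> u /(vsetP _ (is_set_image _ _))[b ba <-].
    by apply: D_opair; [apply: KD; exact: ord_trans aK|apply: DP; [exact: aD|exact: al]].
  - by apply: eD; exact: ord_trans aK.
  move=> [b ba [w wb [be bel zs]]].
  apply: DP => [u /zs[eta [_ etaa] [uM _]]|]; first exact: aD uM.
  apply: card_le_trans Ule; apply: subset_card_le => u /zs[eta [_ etaa] [uM _]].
  by exists eta.
have input_set := is_set_le input_le.
rewrite chain_eq /chain_step; case: pselect => [la|nla] /=.
  by rewrite (vsetE (is_set_le Ule)).
have XD : vset (chain_input chain a) `<=` D by rewrite (vsetE input_set).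
have Xl : vset (chain_input chain a) #<= l by rewrite (vsetE input_set).
split=> //; first exact: weak_closure_sub.
exact: weak_closure_le.
Qed.

Lemma chain_limit a : a ∈ K -> limit_ordinal a ->
  ext (chain a) = \bigcup_(b in ext a) chain b.
Proof.
move=> aK la; rewrite chain_eq /chain_step; case: (pselect (limit_ordinal a)) => //= ?.
apply: vsetE; apply: is_set_bigcup => b _; exact: is_set_ext.
Qed.

Lemma chain_input_sub a : a ∈ K -> ~ limit_ordinal a -> chain_input chain a `<=` chain a.
Proof.
move=> aK nla; have [_ _ /(_ nla)[Xset Xl XD]] := chain_facts aK.
rewrite [chain a]chain_eq /chain_step; case: (pselect (limit_ordinal a)) => //= ?.
rewrite -{1}(vsetE Xset); apply: sub_weak_closure => //; by rewrite (vsetE Xset).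
Qed.

Lemma chain_mono a b : a ∈ K -> b ∈ a -> chain b `<=` chain a.
Proof.
move=> aK ba; have [la|nla] := pselect (limit_ordinal a).
  by move=> y yb; rewrite chain_limit //; exists b.
by move=> y yb; apply: chain_input_sub => //; left; left; exists b.
Qed.

Let chain_total a b c : c ∈ K -> a ∈ c -> b ∈ c ->
  chain a `<=` chain b \/ chain b `<=` chain a.
Proof.
move=> cinK ac bc; have oc := ord_in oK cinK.
have [ab|->|ba] := ord_total (ord_in oc ac) (ord_in oc bc); [left|by left|right].
  by apply: chain_mono => //; exact: ord_trans oK bc cinK.
by apply: chain_mono => //; exact: ord_trans oK ac cinK.
Qed.

Lemma chain_skolem a : a ∈ K -> skolem_closed D vempty (chain a).
Proof.
elim/vin_ind: a => a IH aK; have [la|nla] := pselect (limit_ordinal a).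
  rewrite chain_limit //; apply: skolem_closed_bigcup.
  - by exists vempty; exact: limit0.
  - by move=> b c ba ca; exact: chain_total aK ba ca.
  - by move=> b ba; exists b => //; apply: IH => //; exact: ord_trans aK.
have [_ _ /(_ nla)[Xset Xl XD]] := chain_facts aK.
rewrite chain_eq /chain_step; case: (pselect (limit_ordinal a)) => //= ?.
by apply: weak_closure_skolem => //; rewrite (vsetE Xset).
Qed.

(** At a limit, [weakly_closed_chain] is applied with the approaching set [x] as cofinal set of
    indices. The singletons in [W] give its condition on single pieces, and the enumerated initial
    segments of [x] the one on unions of pieces. *)
Lemma chain_weakly_closed a : a ∈ K -> weakly_closed (chain a).
Proof.
move=> aK; have [la|nla] := pselect (limit_ordinal a); last first.
  have [_ _ /(_ nla)[Xset Xl XD]] := chain_facts aK.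
  rewrite chain_eq /chain_step; case: (pselect (limit_ordinal a)) => //= ?.
  by apply: weak_closure_closed => //; rewrite (vsetE Xset).
have oa := ord_in oK aK; have [x [xa xcof xW]] := W_approaches aK la.
have aP y : y ∈ chain a <-> exists2 b, b ∈ a & y ∈ chain b.
  by change (ext (chain a) y <-> exists2 b, b ∈ a & y ∈ chain b); rewrite chain_limit.
have inK b : b ∈ a -> b ∈ K by move=> ba; exact: ord_trans aK.
have pieces (c w al z : V) : c ∈ a -> W c w -> al ∈ l ->
    z `<=` \bigcup_(eta in ext w) slice h (chain eta) al -> z ∈ chain a.
  (* The piece enters at [c + 1], which is below the limit [a] and, as a successor, takes in its
     input. *)
  move=> ca wc all zs; have sca := limit_succ la ca.
  apply/aP; exists (ord_succ c) => //.
  have nl := not_limit_succ (ord_in oa ca).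
  apply: (chain_input_sub (inK _ sca) nl); right; right.
  exists c; first exact: ord_succ_lt.
  exists w => //; exists al => // y /zs[eta etaw ys]; exists eta => //; split=> //.
  by have [wsub _] := WP (inK c ca) wc; exact: wsub.
apply: (weakly_closed_chain (h := h) (R := vin) (dom := ext a) (c := ext x) (Q := chain) ll vin_wf) => //.
- by move=> d d' da d'a; apply: ord_total; exact: ord_in oa _.
- by move=> d d' da d'a; apply: chain_mono; exact: inK.
- by move=> y /aP.
- move=> d y da; have [_ dl _] := chain_facts (inK d da); exact: (hP dl).1.
- by move=> d /xcof[y yx dy]; exists y => //; case: dy => [|->]; [right|left].
- move=> d al z da all zs; apply: (pieces d _ al z da (W1 d) all) => y /zs ys.
  by exists d => //; apply/(vsetP _ (is_set1 d)).
(* The segment is cut at [d + 1] so that it contains [d] itself. *)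
move=> d al z dx all zs; have [c ca wc] := xW _ (limit_succ la (xa d dx)).
apply: (pieces c _ al z ca wc all) => y /zs[d' [d'x d'd yd' yal]].
by exists d' => //; apply/vsetIP; split=> //; apply/ord_succP; case: d'd => [->|]; [right|left].
Qed.
End Chain.

(** * The chain inside [H(Theta)], and the equivalence *)

Lemma approachable_CECA (l : V) : singular l -> strong_limit l ->
  (forall tau, regular tau -> tau ∈ l ->
     approachability_ideal (succ_card l) (cof_stratum (succ_card l) tau)) ->
  CECA (succ_card l).
Proof.
move=> sl slim appr T cT KT A B AT BT AK BK.
have [cl il cfl] := sl; have [cK iK lK Kl] := succ_cardP cl il; have oK := cK.1.
have lim := infinite_cardinal_limit cK iK.
have [W [W_le WP W1 W_appr]] := approach_family sl appr.
have lT : l ∈ T by exact: ord_trans cT.1 lK KT.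
have DP (x : V) : x `<=` Hset T -> x #<= l -> Hset T x.
  by move=> xT xl; constructor=> //; apply/(card_lt_cardinal _ cT); exists l.
have /choice[h hP] : forall X : V, exists h : V -> V, X #<= l ->
    (forall y, y ∈ X -> h y ∈ l) /\ forall y z, y ∈ X -> z ∈ X -> h y = h z -> y = z.
  move=> X; have [/card_lePf[h hl hinj]|nX] := pselect (X #<= l); last by exists id.
  by exists h.
have [e [eA _ es]] : exists e, set_bij (ext (succ_card l)) (ext A) e.
  by apply/card_set_bijP; rewrite card_eq_sym.
pose M := chain l (Hset T) h W B e.
have KD : succ_card l `<=` Hset T.
  by move=> a aK; apply: ord_Hset => //; exact: ord_trans cT.1 aK KT.
have BD : Hset T B by apply: DP => //; exact/Kl.
have eD b : b ∈ succ_card l -> Hset T (e b) by move=> bK; apply: AT; exact: eA.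
have facts := chain_facts sl slim hP DP KD BD eD W_le WP.
have input := chain_input_sub sl slim hP DP KD BD eD W_le WP.
rewrite /CECA_with (succ_regular cl il).
have K0 := limit0 lim.
have succ_in b : b ∈ succ_card l -> chain_input l h W B e M (ord_succ b) `<=` M (ord_succ b).
  move=> bK; apply: input; first exact: limit_succ.
  exact/not_limit_succ/(ord_in oK bK).
exists M; split.
- split; first split=> [b a ba aK|b bK sbK].
  + exact: (chain_mono sl slim hP DP KD BD eD W_le WP).
  + by apply: succ_in => //; left; right; left.
  + by move=> d dK ld; apply: chain_limit.
- move=> a aK; split; first exact: (chain_weakly_closed sl slim hP DP KD BD eD W_le WP W1 W_appr).
  apply: (skolem_elementary (d0 := vempty)); first by have [] := facts a aK.
  exact: (chain_skolem sl slim hP DP KD BD eD W_le WP).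
- by move=> a aK; apply/Kl; have [] := facts a aK.
- by apply: (input _ K0) => [[]//|]; left; right; right.
- move=> y /es[b bK <-]; exists (ord_succ b); first exact: limit_succ.
  by apply: succ_in => //; right; left; exists b => //; exact: ord_succ_lt.
Qed.

Theorem corollary2 (lambda : V) (lambda_singular : singular lambda)
    (lambda_strong_limit : strong_limit lambda) :
  [<-> approachability_ideal (succ_card lambda) (ext (succ_card lambda));
       forall tau : V, regular tau -> tau ∈ lambda ->
         approachability_ideal (succ_card lambda)
           (cof_stratum (succ_card lambda) tau);
       CECA (succ_card lambda);
       forall tau : V, regular tau -> tau ∈ lambda ->
         CECA_tau tau (succ_card lambda)].
Proof.
tfae.
- by move=> appr tau _ _; apply: approachability_ideal_sub appr => a [].
- exact: approachable_CECA.
- move=> ceca tau rt _ T cT KT A B AT BT AK BK.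
  have [M [chainM closedM smallM BM AM]] := ceca T cT KT A B AT BT AK BK.
  exists M; split; [exact: chainM| |exact: smallM|exact: BM|exact: AM].
  by move=> xi /closedM[closed_xi elementary_xi]; split; first exact: closed_xi.
- exact: CECA_tau_approachable.
Qed.
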